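(* Let $f:\mathbb R^+\times L^2(\Omega)\to L^2(\Omega)$ be a continuous mapping such that $\|f(t,v)\|\le p(t)(1+\|v\|)$ for all $t\ge0$ and $v\in L^2(\Omega)$, where $p:\mathbb R^+\to\mathbb R$ is a nonnegative function with $p\in L^1(0,T)$ for all $T>0$ and $\|p\|_\infty=\operatorname{ess\,sup}_{t\ge0}p(t)<\lambda_1$. Then there exists a bounded absorbing set in $L^2(\Omega)$ for the solutions, with arbitrary initial data $\xi\in C([-\tau,0];L^2(\Omega))$, of the delayed Rayleigh-Stokes problem $$\partial_tu-(1+\gamma\partial_t^\alpha)\Delta u=f(t,u_\rho)\ \text{in }\Omega,\ t>0;\quad u=0\ \text{on }\partial\Omega,\ t\ge 0;\quad u(x,s)=\xi(x,s),\ x\in\Omega,\ s\in[-\tau,0].$$ That is, there exists a bounded set $B\subset L^2(\Omega)$ such that for every $\xi\in C([-\tau,0];L^2(\Omega))$ and every mild solution $u$ on $[-\tau,\infty)$ of the problem with initial datum $\xi$, there is $t_0\ge0$ with $u(\cdot,t)\in B$ for all $t\ge t_0$.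
   Context: Setting: $\Omega\subset\mathbb R^d$ is a bounded domain with smooth boundary, $\gamma>0$, $\alpha\in(0,1)$, $\tau\ge 0$, and $\rho:\mathbb R^+=[0,\infty)\to\mathbb R$ is continuous with $-\tau\le t-\rho(t)\le t$ for all $t\ge0$ and $\lim_{t\to\infty}(t-\rho(t))=\infty$; $u_\rho(x,t)=u(x,t-\rho(t))$. $\|\cdot\|$ is the norm of $L^2(\Omega)$. $\partial_t^\alpha v(t)=\frac{d}{dt}\int_0^tg_{1-\alpha}(t-s)v(s)ds$ is the Riemann-Liouville derivative, $g_\beta(t)=t^{\beta-1}/\Gamma(\beta)$. For $\mu>0$, $\omega(\cdot,\mu)$ is the unique solution of $\omega'(t)+\mu(1+\gamma\partial_t^\alpha)\omega(t)=0$ for $t>0$, $\omega(0)=1$; equivalently, the unique continuous solution of $\omega(t)+\mu\int_0^t(1+\gamma g_{1-\alpha}(t-s))\omega(s)ds=1$, $t\ge0$. $\{\varphi_n\}_{n\ge1}$ is an orthonormal basis of $L^2(\Omega)$ consisting of eigenfunctions of $-\Delta$ with homogeneous Dirichlet boundary condition, $-\Delta\varphi_n=\lambda_n\varphi_n$, with $0<\lambda_1\le\lambda_2\le\cdots\to\infty$. The resolvent operator $S(t):L^2(\Omega)\to L^2(\Omega)$ is $S(t)v=\sum_{n=1}^\infty\omega(t,\lambda_n)\langle v,\varphi_n\rangle\varphi_n$, $t\ge0$. Mild solution on $[-\tau,\infty)$: a continuous $u:[-\tau,\infty)\to L^2(\Omega)$ with $u(\cdot,s)=\xi(\cdot,s)$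 for $s\in[-\tau,0]$ and $u(\cdot,t)=S(t)\xi(\cdot,0)+\int_0^tS(t-s)f(s,u_\rho(\cdot,s))ds$ for all $t\ge0$. *)

(* Defs.v *)
From HB Require Import structures.
From mathcomp Require Import all_boot all_order all_algebra.
From mathcomp Require Import all_classical all_reals all_analysis.
From mathcomp Require Import measurable_realfun ess_sup_inf.

Set Implicit Arguments.
Unset Strict Implicit.
Unset Printing Implicit Defensive.

Import Order.TTheory GRing.Theory Num.Theory.
Import numFieldNormedType.Exports.

Local Open Scope classical_set_scope.
Local Open Scope ring_scope.
Local Open Scope quotient_scope.

(** MathComp-Analysis has the functions of finite L^p norm ([LfunType]) but no
    normed structure on their classes: [Lp] is the quotient of [LfunType] by
    almost everywhere equality, with its [normedModType] structure. *)
Section Lp.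
Context d (T : measurableType d) (R : realType).
Variables (mu : {measure set T -> \bar R}) (p : \bar R) (p1 : (1 <= p)%E).
Implicit Types f g h : LfunType mu p1.

Definition Lfun_ae_eq f g : bool := `[< f = g %[ae mu] >].

Let Lfun_ae_eq_refl : reflexive Lfun_ae_eq.
Proof. by move=> f; apply/asboolP; exact: ae_eq_refl. Qed.

Let Lfun_ae_eq_sym : symmetric Lfun_ae_eq.
Proof. by move=> f g; apply/idP/idP => /asboolP h; apply/asboolP/ae_eq_sym. Qed.

Let Lfun_ae_eq_trans : transitive Lfun_ae_eq.
Proof. by move=> f g h /asboolP gf /asboolP fh; apply/asboolP/(ae_eq_trans gf fh). Qed.

Canonical Lfun_ae_eq_equiv :=
  EquivRel Lfun_ae_eq Lfun_ae_eq_refl Lfun_ae_eq_sym Lfun_ae_eq_trans.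

Definition Lp : Type := {eq_quot Lfun_ae_eq}.
HB.instance Definition _ := Choice.on Lp.
HB.instance Definition _ := EqQuotient.on Lp.

Definition Lp_fun (u : Lp) : T -> R := (repr u : LfunType mu p1).
Coercion Lp_fun : Lp >-> Funclass.

Lemma Lp_piP f g : \pi_Lp f = \pi_Lp g <-> f = g %[ae mu].
Proof.
by split=> [/eqP|h]; [rewrite eqmodE => /asboolP|apply/eqP; rewrite eqmodE; exact/asboolP].
Qed.

Lemma repr_piP f : (repr (\pi_Lp f) : LfunType mu p1) = f %[ae mu].
Proof. by apply/Lp_piP; rewrite reprK. Qed.

Definition Lp_zero : Lp := \pi_Lp 0.
Definition Lp_opp (u : Lp) : Lp := \pi_Lp (- repr u).
Definition Lp_add (u v : Lp) : Lp := \pi_Lp (repr u + repr v).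
Definition Lp_scale (a : R) (u : Lp) : Lp := \pi_Lp (a *: repr u).
Definition Lp_norm (u : Lp) : R := fine ('N[mu]_p[EFin \o Lp_fun u]).



Lemma Lp_pi_opp f : Lp_opp (\pi_Lp f) = \pi_Lp (- f).
Proof.
by apply/Lp_piP; apply: filterS (repr_piP f) => x h _; congr (- _); exact: h.
Qed.

Lemma Lp_pi_add f g : Lp_add (\pi_Lp f) (\pi_Lp g) = \pi_Lp (f + g).
Proof.
apply/Lp_piP; apply: filterS2 (repr_piP f) (repr_piP g) => x h k _.
by congr (_ + _); [exact: h|exact: k].
Qed.

Lemma Lp_pi_scale a f : Lp_scale a (\pi_Lp f) = \pi_Lp (a *: f).
Proof.
by apply/Lp_piP; apply: filterS (repr_piP f) => x h _; congr (_ * _); exact: h.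
Qed.


Let measurable_normX (g : T -> R) (q : R) : measurable_fun setT g ->
  measurable_fun setT ((fun x => `|(EFin \o g) x| `^ q)%E : T -> \bar R).
Proof.
move=> mg; apply: (measurableT_comp (measurable_poweR _)) => //.
by apply: measurableT_comp => //; exact/measurable_EFinP.
Qed.

Lemma Lnorm_ae_eq (g h : T -> R) : measurable_fun setT g ->
  measurable_fun setT h -> g = h %[ae mu] ->
  ('N[mu]_p[EFin \o g] = 'N[mu]_p[EFin \o h])%E.
Proof.
move=> mg mh gh; rewrite unlock; case: p p1 => [q q1|q1|//].
- congr (_ `^ _)%E; apply: ge0_ae_eq_integral => //.
  + exact: measurable_normX.
  + exact: measurable_normX.
  + by move=> x _; exact: poweR_ge0.
  + by move=> x _; exact: poweR_ge0.
  + by apply: filterS gh => x gh _ /=; rewrite (gh I).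
- by case: ifP => // _; apply: eq_ess_sup; apply: filterS gh => x /= ->.
Qed.

Lemma Lp_pi_norm f : Lp_norm (\pi_Lp f) = fine ('N[mu]_p[EFin \o f]).
Proof.
congr fine; apply: Lnorm_ae_eq; [exact: measurable_funPT..|exact: repr_piP].
Qed.

Let Lp_addA : associative Lp_add.
Proof.
move=> u v w; rewrite -(reprK u) -(reprK v) -(reprK w).
move: (repr u) (repr v) (repr w) => f g h.
by rewrite (Lp_pi_add g h) (Lp_pi_add f g) 2!Lp_pi_add addrA.
Qed.

Let Lp_addC : commutative Lp_add.
Proof. by move=> u v; rewrite -(reprK u) -(reprK v) !Lp_pi_add addrC. Qed.

Let Lp_add0 : left_id Lp_zero Lp_add.
Proof. by move=> u; rewrite -(reprK u) Lp_pi_add add0r. Qed.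

Let Lp_addN : left_inverse Lp_zero Lp_opp Lp_add.
Proof. by move=> u; rewrite -(reprK u); move: (repr u) => f; rewrite Lp_pi_opp Lp_pi_add addNr. Qed.

HB.instance Definition _ :=
  GRing.isZmodule.Build Lp Lp_addA Lp_addC Lp_add0 Lp_addN.

Let Lp_scaleA a b (u : Lp) : Lp_scale a (Lp_scale b u) = Lp_scale (a * b) u.
Proof.
rewrite -(reprK u); move: (repr u) => f.
by rewrite (Lp_pi_scale b f) 2!Lp_pi_scale scalerA.
Qed.

Let Lp_scale1 : left_id 1 Lp_scale.
Proof. by move=> u; rewrite -(reprK u) Lp_pi_scale scale1r. Qed.

Let Lp_scaleDr : right_distributive Lp_scale +%R.
Proof.
move=> a u v; rewrite -(reprK u) -(reprK v).
move: (repr u) (repr v) => f g.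
have -> : \pi_Lp f + \pi_Lp g = \pi_Lp (f + g) :> Lp by exact: Lp_pi_add.
by rewrite 3!Lp_pi_scale [RHS]Lp_pi_add scalerDr.
Qed.

Let Lp_scaleDl u : {morph Lp_scale^~ u : a b / a + b}.
Proof.
move=> a b; rewrite -(reprK u).
by rewrite 3!Lp_pi_scale [RHS]Lp_pi_add scalerDl.
Qed.

HB.instance Definition _ :=
  GRing.Zmodule_isLmodule.Build R Lp Lp_scaleA Lp_scale1 Lp_scaleDr Lp_scaleDl.

Let Lp_normD (u v : Lp) : Lp_norm (u + v) <= Lp_norm u + Lp_norm v.
Proof.
rewrite -(reprK u) -(reprK v) [X in Lp_norm X]Lp_pi_add !Lp_pi_norm.
exact: ler_LnormD.
Qed.

Let Lp_normZ (a : R) (u : Lp) : Lp_norm (a *: u) = `|a| * Lp_norm u.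
Proof.
rewrite -(reprK u) [X in Lp_norm X]Lp_pi_scale !Lp_pi_norm.
by apply: EFin_inj; rewrite EFinM !finite_norm_fine -LnormZ.
Qed.

Let Lp_norm0_eq0 (u : Lp) : Lp_norm u = 0 -> u = 0.
Proof.
rewrite -(reprK u) Lp_pi_norm => /fine_Lnormr_eq0 u0.
exact/Lp_piP.
Qed.

HB.instance Definition _ :=
  Lmodule_isNormed.Build R Lp Lp_normD Lp_normZ Lp_norm0_eq0.

End Lp.

Section pushforward_measure.
Context d1 d2 (T1 : measurableType d1) (T2 : measurableType d2) (R : realType).

Definition pushforward_measure (m : {measure set T1 -> \bar R}) (f : T1 -> T2)
    (mf : measurable_fun setT f) : {measure set T2 -> \bar R} :=
  measure_function_pushforward__canonical__measure_function_Measure m mf.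

End pushforward_measure.

Section lebesgue_rV.
Variable R : realType.

(** Lebesgue measure on R^n, see [lebesgue_tuple_box] and [lebesgue_rV_box]. *)
Fixpoint lebesgue_tuple (n : nat) :
    {measure set (n.-tuple (measurableTypeR R)) -> \bar R} :=
  match n with
  | 0 => dirac [tuple]
  | m.+1 => pushforward_measure (lebesgue_measure \x^ lebesgue_tuple m)%E
      (measurable_cons measurable_fst measurable_snd)
  end.

Definition borel_rV (d : nat) := g_sigma_algebraType (@open 'rV[R]_d).

Definition rV_of_tuple (d : nat) (t : d.-tuple (measurableTypeR R)) : borel_rV d :=
  (\row_i tnth t i : 'rV[R]_d).

Lemma measurable_rV_of_tuple d : measurable_fun setT (@rV_of_tuple d).
Proof.
apply: (@measurability _ _ _ (borel_rV d) _ _ (@open 'rV[R]_d)) => //.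
move=> _ [U oU <-]; rewrite setTI.
pose B (z : 'rV[rat]_d * nat) : set 'rV[R]_d :=
  ball (map_mx ratr z.1 : 'rV[R]_d) z.2.+1%:R^-1.
pose C z : set 'rV[R]_d := if pselect (B z `<=` U) then B z else set0.
have -> : U = \bigcup_z C z.
  apply/seteqP; split => [x Ux|x [z _]]; last first.
    by rewrite /C; case: (pselect _) => [BU|//]; exact: BU.
  have [e /= e0 xeU] := (nbhs_ballP _ _).1 (open_nbhs_nbhs (conj oU Ux)).
  pose k := Num.truncn (2 / e).
  have ke : k.+1%:R^-1 < e / 2.
    by rewrite invf_plt ?posrE ?divr_gt0// invf_div truncnS_gt// divr_ge0// ltW.
  have k0 : 0 < k.+1%:R^-1 :> R by rewrite invr_gt0 ltr0n.
  have /choice[q qx] : forall i, exists r : rat, `|x ord0 i - ratr r| < k.+1%:R^-1.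
    move=> i.
    have /rat_in_itvoo[r] : x ord0 i - k.+1%:R^-1 < x ord0 i + k.+1%:R^-1.
      by rewrite ltrBlDr -addrA ltrDl addr_gt0.
    by rewrite in_itv/= => rx; exists r; rewrite distrC ltr_distl.
  pose q' : 'rV[rat]_d := \row_i q i.
  pose m : 'rV[R]_d := map_mx ratr q'.
  have xB : B (q', k) x.
    split => // i j; rewrite !mxE ord1 /ball/= distrC; exact: qx.
  exists (q', k) => //; rewrite /C; case: (pselect _) => // nB; exfalso; apply: nB => y [_ qy].
  apply: xeU; split => // i j.
  rewrite [e]splitr.
  apply: (@ball_triangle _ _ (m i j)).
    have [_ /(_ i j)] := xB => /ball_sym; exact/le_ball/ltW.
  by have := qy i j; exact/le_ball/ltW.
rewrite preimage_bigcup; apply: countable_bigcupT_measurable.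
  exact: countableP.
move=> z; rewrite /C; case: (pselect _) => [BU|nBU]; last by rewrite preimage_set0.
have -> : @rV_of_tuple d @^-1` B z = \bigcap_(i in [set: 'I_d])
    ((@tnth d _ ^~ i) @^-1` ball (ratr (z.1 ord0 i) : R) z.2.+1%:R^-1).
  apply/seteqP; split => [t [_ tB] i _|t tB].
    by have := tB ord0 i; rewrite !mxE.
  split; first by rewrite invr_gt0 ltr0n.
  by move=> i j; rewrite !mxE (ord1 i); exact: tB.
apply: fin_bigcap_measurable; first exact: finite_finset.
move=> i _; rewrite -[X in measurable X]setTI; apply: measurable_tnth => //.
exact: measurable_ball.
Qed.

Definition lebesgue_rV (d : nat) : {measure set (borel_rV d) -> \bar R} :=
  pushforward_measure (lebesgue_tuple d) (@measurable_rV_of_tuple d).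


Lemma lebesgue_tuple_box n (A : 'I_n -> set (measurableTypeR R)) :
  (forall i, measurable (A i)) ->
  lebesgue_tuple n [set t | forall i, A i (tnth t i)] =
  (\prod_(i < n) lebesgue_measure (A i))%E.
Proof.
elim: n A => [A _|n IH A mA].
  rewrite big_ord0 /= diracE mem_set//; by case.
set B := [set t : n.-tuple (measurableTypeR R) | forall i, A (lift ord0 i) (tnth t i)].
have mB : measurable B.
  have -> : B = \bigcap_(i in [set: 'I_n]) ((@tnth n _ ^~ i) @^-1` A (lift ord0 i)).
    by apply/seteqP; split => [t tB i _|t tB i]; [exact: tB|exact: tB].
  apply: fin_bigcap_measurable; first exact: finite_finset.
  by move=> i _; rewrite -[X in measurable X]setTI; apply: measurable_tnth.
rewrite big_ord_recl.
rewrite -(IH (fun i => A (lift ord0 i)))//.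
transitivity ((lebesgue_measure \x^ lebesgue_tuple n)%E (A ord0 `*` B)); last first.
  by rewrite product_measure2E//.
rewrite /= /pushforward; congr (_ _).
apply/seteqP; split => [[x t] /= h|[x t] [/= hx ht] i].
  by split; [have := h ord0; rewrite tnth0|move=> i; have := h (lift ord0 i); rewrite tnthS].
by have [j ->|->] := unliftP ord0 i; rewrite ?tnthS ?tnth0//; exact: ht.
Qed.

Lemma lebesgue_rV_box d (A : 'I_d -> set (measurableTypeR R)) :
  (forall i, measurable (A i)) ->
  lebesgue_rV d [set x : 'rV[R]_d | forall i, A i (x ord0 i)] =
  (\prod_(i < d) lebesgue_measure (A i))%E.
Proof.
move=> mA; rewrite -lebesgue_tuple_box//= /pushforward; congr (_ _).
by apply/seteqP; split => t h i; have := h i; rewrite mxE.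
Qed.

End lebesgue_rV.

Section smooth_domains.
Context (R : realType) (d : nat).
Implicit Types (U A : set 'rV[R]_d) (h : 'rV[R]_d -> R).

Definition partial (i : 'I_d) h : 'rV[R]_d -> R := 'D_(delta_mx ord0 i) h.

Definition laplacian h (x : 'rV[R]_d) : R := \sum_i partial i (partial i h) x.

(** [h] is of class C^k on the open set [U]. *)
Fixpoint Ck_on (k : nat) U h : Prop :=
  (forall x, U x -> {for x, continuous h}) /\
  if k is k'.+1 then
    forall i, (forall x, U x -> derivable h x (delta_mx ord0 i)) /\
              Ck_on k' U (partial i h)
  else True.

Definition boundary A : set 'rV[R]_d := closure A `\` A°.

(** [A] is locally, near each of its boundary points, the sublevel set of a
    C^oo function without critical point. *)
Definition smooth_boundary A : Prop :=
  forall x, boundary A x -> exists (U : set 'rV[R]_d) (h : 'rV[R]_d -> R),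
    [/\ open U, U x, forall k, Ck_on k U h,
        forall y, U y -> exists i, partial i h y != 0 &
        A `&` U = [set y | h y < 0] `&` U].

Record smooth_bounded_domain := SmoothBoundedDomain {
  domain :> set 'rV[R]_d ;
  domain_nonempty : domain !=set0 ;
  domain_open : open domain ;
  domain_connected : connected domain ;
  domain_bounded : bounded_set domain ;
  domain_smooth : smooth_boundary domain }.

Variable Om : smooth_bounded_domain.

Lemma measurable_domain : measurable (Om : set (borel_rV R d)).
Proof. by apply: sub_sigma_algebra; exact: domain_open. Qed.

Definition lebesgue_on : {measure set (borel_rV R d) -> \bar R} :=
  mrestr (lebesgue_rV R d) measurable_domain.

End smooth_domains.

Notation L2 Om := (Lp (lebesgue_on Om) (lee1n 2)).

Section L2_domain.
Context (R : realType) (d : nat) (Om : smooth_bounded_domain R d).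

Definition L2_inner (u v : L2 Om) : R := \int[lebesgue_on Om]_x (u x * v x).

Definition orthonormal_basis (phi : nat -> L2 Om) : Prop :=
  (forall i j, L2_inner (phi i) (phi j) = (i == j)%:R) /\
  (forall v : L2 Om, series (fun n => L2_inner v (phi n) *: phi n) @ \oo --> v).

(** Eigenfunctions are understood in the classical sense: the class [phi] has a
    representative in C^2(Om) and C(closure Om). *)
Definition dirichlet_eigenfunction (lam : R) (phi : L2 Om) : Prop :=
  exists e : 'rV[R]_d -> R,
    [/\ Ck_on 2 Om e,
        {within closure Om, continuous e},
        forall x, boundary Om x -> e x = 0,
        forall x, domain Om x -> - laplacian e x = lam * e x &
        phi = e %[ae lebesgue_on Om] ].

End L2_domain.

Section bochner_integral.
Context d (T : measurableType d) (R : realType).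
Variables (mu : {measure set T -> \bar R}) (V : normedModType R).
Implicit Types (D : set T) (s F : T -> V).

Definition simple_map s : Prop :=
  finite_set (range s) /\ forall v, measurable (s @^-1` [set v]).

Definition simple_integrable D s : Prop :=
  forall v, v != 0 -> (mu (D `&` s @^-1` [set v]) < +oo)%E.

Definition simple_integral D s : V :=
  \sum_(v \in range s) fine (mu (D `&` s @^-1` [set v])) *: v.

(** The measurability of the norms makes sense of the integrals of the next line;
    it holds whenever [F] is strongly measurable. *)
Definition is_bochner_integral D F (I : V) : Prop :=
  exists s : nat -> T -> V,
    [/\ forall n, simple_map (s n) /\ simple_integrable D (s n),
        forall n, measurable_fun D (fun x => `|F x - s n x|),
        (\int[mu]_(x in D) (`|F x - s n x|)%:E)%E @[n --> \oo] --> 0%E &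
        simple_integral D (s n) @[n --> \oo] --> I].

End bochner_integral.

Section fractional_relaxation.
Context (R : realType).
Implicit Types (alpha mu t : R) (v w : R -> R).

Definition Gamma (b : R) : R :=
  \int[lebesgue_measure]_(x in `]0, +oo[) (x `^ (b - 1) * expR (- x)).

(** As [powR] is total, [gker b 0] is 0 for b < 1; this affects only the endpoint
    s = t of the convolution below. *)
Definition gker (b t : R) : R := t `^ (b - 1) / Gamma b.

Definition rl_convolution alpha v t : R :=
  \int[lebesgue_measure]_(s in `[0, t]) (gker (1 - alpha) (t - s) * v s).

Definition rl_derivative alpha v : R -> R := derive1 (rl_convolution alpha v).

Definition relaxation_solution (gamma : R) alpha mu w : Prop :=
  [/\ {within `[0, +oo[, continuous w},
      w 0 = 1 &
      forall t, 0 < t ->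
        [/\ derivable w t 1,
            derivable (rl_convolution alpha w) t 1 &
            derive1 w t + mu * (w t + gamma * rl_derivative alpha w t) = 0]].

End fractional_relaxation.

Section rayleigh_stokes.
Context (R : realType) (d : nat) (Om : smooth_bounded_domain R d).

(** For omega bounded in its second argument the series converges in L2, so that
    [lim] is its sum. *)
Definition resolvent (omega : R -> R -> R) (lam : nat -> R) (phi : nat -> L2 Om)
    (t : R) (v : L2 Om) : L2 Om :=
  lim (series (fun n => (omega t (lam n) * L2_inner v (phi n)) *: phi n) @ \oo).

Definition mild_solution (S : R -> L2 Om -> L2 Om) (tau : R) (rho : R -> R)
    (f : R -> L2 Om -> L2 Om) (xi u : R -> L2 Om) : Prop :=
  [/\ {within `[- tau, +oo[, continuous u},
      forall s, - tau <= s <= 0 -> u s = xi s &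
      forall t, 0 <= t -> exists2 I : L2 Om,
        is_bochner_integral lebesgue_measure `[0, t]
          (fun s => S (t - s) (f s (u (s - rho s)))) I &
        u t = S t (xi 0) + I].

End rayleigh_stokes.

(* Main.v *)
Require Import Defs.
From mathcomp Require Import all_boot all_order all_algebra.
From mathcomp Require Import all_classical all_reals all_analysis.
From mathcomp Require Import measurable_realfun ess_sup_inf.
From mathcomp Require Import lra ring.
From mathcomp Require finmap.

Set Implicit Arguments.
Unset Strict Implicit.
Unset Printing Implicit Defensive.

Import Order.TTheory GRing.Theory Num.Theory.
Import numFieldNormedType.Exports.

Local Open Scope classical_set_scope.
Local Open Scope ring_scope.

(** The relaxation equation is integrated to [w + mu k * w = 1] with the kernel
    [k t = 1 + c t^-alpha], which is nonincreasing and log-convex. For such a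
    kernel, a solution of [w + mu k * w = F] with [w 0 > 0] and [F / k]
    nondecreasing stays positive: at a first zero [t1], log-convexity bounds
    [k (t1 - s) / k (t - s)] by [k t1 / k t], so that the whole history up to [t]
    is controlled by the equation at [t]. This gives that [omega] is positive,
    nonincreasing in [t] and in [mu], has integral at most [1 / mu], and tends
    to [0].

    Hence [|S t| <= omega t lambda_1], and [|f t v| <= P (1 + |v|)] for some
    [P < lambda_1] and all [t], so [y = |u|] satisfies
    [y t <= w t y(0) + int_0^t w (t - s) P (1 + y (s - rho s)) ds] with
    [int w <= 1 / lambda_1]. Evaluating at a maximum shows that [y] is bounded. If
    [m] bounds [y] eventually, then so does [P (1 + m) / lambda_1 + e] for all
    [e > 0]; the least eventual bound is therefore at most
    [P / (lambda_1 - P)], the fixed point of this affine contraction. *)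

(** * Inner product of [L2 Om], Bessel's inequality and the norm of the resolvent *)

Section L2_geometry.
Context (R : realType) (d : nat) (Om : smooth_bounded_domain R d).
Implicit Types u v w : L2 Om.

Lemma Lp_fun_in_Lfun u : (u : _ -> R) \in Lfun (lebesgue_on Om) 2%:E.
Proof. exact: (valP (repr u)). Qed.

Lemma L2_measurable u : measurable_fun setT (u : _ -> R).
Proof. by have := Lp_fun_in_Lfun u; rewrite inE => /andP[+ _]; rewrite inE. Qed.

Lemma L2_mul_integrable u v :
  (lebesgue_on Om).-integrable setT (EFin \o (fun x => u x * v x)).
Proof.
by apply/Lfun1_integrable; apply: Lfun2_mul_Lfun1; exact: Lp_fun_in_Lfun.
Qed.

(** The representative chosen for a sum or a multiple of classes agrees with the pointwise operation
    only almost everywhere; this allows computing with explicit representatives instead. *)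
Lemma L2_inner_ae (a b : borel_rV R d -> R) u v :
  measurable_fun setT a -> measurable_fun setT b ->
  u = a %[ae lebesgue_on Om] -> v = b %[ae lebesgue_on Om] ->
  L2_inner u v = \int[lebesgue_on Om]_x (a x * b x).
Proof.
move=> ma mb ua vb; congr fine; apply: ae_eq_integral => //.
- by apply/measurable_EFinP; apply: measurable_funM; exact: L2_measurable.
- by apply/measurable_EFinP; exact: measurable_funM.
- by apply: filterS2 ua vb => x /= ua vb _; rewrite ua // vb.
Qed.

Lemma L2_innerC u v : L2_inner u v = L2_inner v u.
Proof. by apply: eq_Rintegral => x _; rewrite mulrC. Qed.

Lemma L2_innerDl u v w : L2_inner (u + v) w = L2_inner u w + L2_inner v w.
Proof.
rewrite (@L2_inner_ae (fun x => u x + v x) w).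
- rewrite -RintegralD//; [|exact: L2_mul_integrable..].
  by apply: eq_Rintegral => x _; rewrite mulrDl.
- by apply: measurable_funD; exact: L2_measurable.
- exact: L2_measurable.
- exact: repr_piP.
- exact: ae_eq_refl.
Qed.

Lemma L2_innerZl (a : R) u v : L2_inner (a *: u) v = a * L2_inner u v.
Proof.
rewrite (@L2_inner_ae (fun x => a * u x) v).
- rewrite -RintegralZl//; last exact: L2_mul_integrable.
  by apply: eq_Rintegral => x _; rewrite mulrA.
- by apply: measurable_funM => //; exact: L2_measurable.
- exact: L2_measurable.
- exact: repr_piP.
- exact: ae_eq_refl.
Qed.

Lemma L2_innerDr u v w : L2_inner u (v + w) = L2_inner u v + L2_inner u w.
Proof. by rewrite L2_innerC L2_innerDl !(L2_innerC u). Qed.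

Lemma L2_innerZr (a : R) u v : L2_inner u (a *: v) = a * L2_inner u v.
Proof. by rewrite L2_innerC L2_innerZl (L2_innerC u). Qed.

Lemma L2_inner_norm u : L2_inner u u = `|u| ^+ 2.
Proof.
have -> : `|u| = fine ('N[lebesgue_on Om]_2%:E[EFin \o u]) by [].
rewrite unlock /= /L2_inner /Rintegral.
have -> : (\int[lebesgue_on Om]_x (u x * u x)%:E =
    \int[lebesgue_on Om]_x (`|(EFin \o u) x| `^ 2))%E.
  apply: eq_integral => x _ /=.
  by rewrite powR_mulrn// -normrX ger0_norm ?sqr_ge0// expr2.
set I := (\int[_]_x _)%E.
have I0 : (0 <= I)%E by apply: integral_ge0 => x _; exact: poweR_ge0.
have Ifin : I \is a fin_num.
  have /integrable_fin_num := L2_mul_integrable u u.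
  move=> /(_ measurableT); congr (_ \is a fin_num).
  apply: eq_integral => x _ /=.
  by rewrite powR_mulrn// -normrX ger0_norm ?sqr_ge0// expr2.
rewrite -(fineK Ifin) /= -powR_mulrn ?powR_ge0// -powRrM mulVf ?pnatr_eq0//.
by rewrite powRr1// fine_ge0.
Qed.

Lemma L2_norm_sum_sqr (phi : nat -> L2 Om) (b : nat -> R) (N : nat) :
  (forall i j, L2_inner (phi i) (phi j) = (i == j)%:R) ->
  `|\sum_(0 <= n < N) b n *: phi n| ^+ 2 = \sum_(0 <= n < N) b n ^+ 2.
Proof.
move=> ortho.
have perp M j : (M <= j)%N ->
    L2_inner (\sum_(0 <= n < M) b n *: phi n) (phi j) = 0.
  elim: M => [_|M IH Mj].
    by rewrite big_nil -[0](scale0r (phi 0%N)) L2_innerZl mul0r.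
  rewrite big_nat_recr//= L2_innerDl IH ?(ltnW Mj)// L2_innerZl ortho.
  by rewrite ltn_eqF// mulr0 addr0.
elim: N => [|N IH]; first by rewrite !big_nil normr0 expr0n.
rewrite !big_nat_recr//= -IH -!L2_inner_norm L2_innerDl !L2_innerDr.
rewrite !L2_innerZl !L2_innerZr perp// L2_innerC perp// ortho eqxx.
by rewrite !mulr0 addr0 add0r mulr1 expr2.
Qed.

(** By Pythagoras each squared coefficient is multiplied by at most [c ^+ 2]; Bessel's inequality
    bounds the rest. *)
Lemma L2_norm_sum_le (phi : nat -> L2 Om) (a : nat -> R) (c : R) v N :
  orthonormal_basis phi -> (forall n, `|a n| <= c) ->
  `|\sum_(0 <= n < N) (a n * L2_inner v (phi n)) *: phi n| <= c * `|v|.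
Proof.
move=> [ortho basis] ac.
have c0 : 0 <= c by exact: le_trans (ac 0%N).
(* The norms of the partial sums increase with the number of terms and converge to [|v|]. *)
have bessel : \sum_(0 <= n < N) L2_inner v (phi n) ^+ 2 <= `|v| ^+ 2.
  rewrite -(L2_norm_sum_sqr _ _ ortho).
  have nb : `|series (fun n => L2_inner v (phi n) *: phi n) n| @[n --> \oo] --> `|v|.
    exact: cvg_norm.
  rewrite ler_sqr ?nnegrE//.
  apply: (cvgr_to_ge nb); exists N => // M /= NM.
  rewrite -ler_sqr ?nnegrE// !L2_norm_sum_sqr//.
  by rewrite [leRHS](big_cat_nat _ NM)//= lerDl sumr_ge0// => i _; exact: sqr_ge0.
rewrite -ler_sqr ?nnegrE ?mulr_ge0// L2_norm_sum_sqr// exprMn.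
apply: (@le_trans _ _ (c ^+ 2 * \sum_(0 <= n < N) L2_inner v (phi n) ^+ 2)).
  rewrite big_distrr/=; apply: ler_sum => n _.
  by rewrite exprMn ler_wpM2r ?sqr_ge0// -(real_normK (num_real (a n))) ler_sqr ?nnegrE.
by rewrite ler_wpM2l ?sqr_ge0.
Qed.

(* Completeness of [L2 Om] is not needed: if the series diverged, its [lim] would
   be [0]. *)
Lemma resolvent_norm_le (omega : R -> R -> R) (lam : nat -> R) (phi : nat -> L2 Om)
    (t c : R) v :
  orthonormal_basis phi -> (forall n, `|omega t (lam n)| <= c) ->
  `|resolvent omega lam phi t v| <= c * `|v|.
Proof.
move=> basis oc; rewrite /resolvent.
have c0 : 0 <= c by exact: le_trans (oc 0%N).
set s := series _.
have [cs|/dvgP ->] := pselect (cvgn s).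
  have ns : `|s n| @[n --> \oo] --> `|limn s| by exact: cvg_norm.
  apply: (cvgr_to_le ns); apply: nearW => N.
  exact: (L2_norm_sum_le _ _ basis oc).
by rewrite normr0 mulr_ge0.
Qed.

End L2_geometry.

(** * Reflections and translations in Lebesgue integrals *)

Section lebesgue_isometries.
Context (R : realType).
Notation mu := (@lebesgue_measure R).

Lemma measurable_reflection (c : R) :
  measurable_fun setT (fun x : measurableTypeR R => (c - x : measurableTypeR R)).
Proof. by apply: measurable_funB. Qed.

Lemma lebesgue_measure_reflection (c : R) (A : set (measurableTypeR R)) :
  measurable A -> mu A = pushforward mu (fun x => c - x) A.
Proof.
move=> mA.
rewrite (lebesgue_measure_unique
  (mu := pushforward_measure mu (measurable_reflection c)))//.
move=> _ [[a b] _ <-] /=; rewrite /pushforward.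
have -> : (fun x => c - x) @^-1` `]a, b] = `[c - b, c - a[%classic.
  by apply/seteqP; split => x /=; rewrite !in_itv/=; lra.
rewrite !lebesgue_measure_itv/= !lte_fin ltrD2l ltrN2.
by case: ifP => // _; rewrite -!EFinB; congr EFin; lra.
Qed.

Lemma ge0_integral_reflection (c : R) (D : set R) (f : R -> R) :
  measurable D -> measurable_fun D f -> (forall x, D x -> 0 <= f x) ->
  (\int[mu]_(x in D) (f x)%:E =
   \int[mu]_(x in [set x | D (c - x)%R]) (f (c - x)%R)%:E)%E.
Proof.
move=> mD mf f0.
rewrite -(@ge0_integral_pushforward _ _ _ _ _ _ (measurable_reflection c) mu D
  (EFin \o f))//; last 2 first.
- exact/measurable_EFinP.
- by move=> y /set_mem Dy; rewrite lee_fin f0.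
apply: eq_measure_integral => [|mr A mA _]; first exact: measurable_reflection.
exact: lebesgue_measure_reflection.
Qed.

(** A translation is the composition of the reflections [x |-> h - x] and [x |-> - x]. *)
Lemma ge0_integral_translation (h : R) (D : set R) (f : R -> R) :
  measurable D -> measurable_fun D f -> (forall x, D x -> 0 <= f x) ->
  (\int[mu]_(x in D) (f x)%:E =
   \int[mu]_(x in [set x | D (x + h)%R]) (f (x + h)%R)%:E)%E.
Proof.
move=> mD mf f0.
rewrite (ge0_integral_reflection h mD mf f0).
have mr A : measurable A -> measurable [set x : R | A (h - x)].
  by move=> mA; rewrite -[X in measurable X]setTI; exact: measurable_reflection.
rewrite (@ge0_integral_reflection 0 _ (fun x => f (h - x))).
- by congr (integral _ _ _); apply/funext => x /=; rewrite sub0r opprK addrC.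
- exact: mr.
- apply: (measurable_comp mD) mf _ => //.
    by move=> _ [x Dx <-].
  by apply: measurable_funTS; exact: measurable_reflection.
- by move=> x; exact: f0.
Qed.

End lebesgue_isometries.

(** * The kernel of the integrated equation: monotonicity, log-convexity, mass near 0 *)

Section rayleigh_stokes_kernel.
Context (R : realType).
Notation mu := (@lebesgue_measure R).
Variables (c alpha : R).
Hypotheses (c0 : 0 <= c) (alpha0 : 0 < alpha) (alpha1 : alpha < 1).

(** For [c = gamma / Gamma (1 - alpha)] this is $1 + \gamma g_{1-\alpha}$. As [powR] is total, the
    singularity at 0 is replaced by the value 1, so monotonicity and log-convexity hold for positive
    arguments only. *)
Definition rs_kernel (t : R) : R := 1 + c * t `^ (- alpha).

Lemma rs_kernel_ge1 t : 1 <= rs_kernel t.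
Proof. by rewrite lerDl mulr_ge0// powR_ge0. Qed.

Lemma rs_kernel_gt0 t : 0 < rs_kernel t.
Proof. exact: lt_le_trans (rs_kernel_ge1 t). Qed.

Lemma measurable_rs_kernel : measurable_fun setT rs_kernel.
Proof.
apply: measurable_funD => //; apply: measurable_funM => //.
Qed.

Lemma powRN_nonincreasing (a b : R) : 0 < a -> a <= b -> b `^ (- alpha) <= a `^ (- alpha).
Proof.
move=> a0 ab; have b0 := lt_le_trans a0 ab.
rewrite !powRN lef_pV2 ?posrE ?powR_gt0//.
by rewrite ge0_ler_powR ?nnegrE// ltW.
Qed.

Lemma rs_kernel_nonincreasing (a b : R) : 0 < a -> a <= b -> rs_kernel b <= rs_kernel a.
Proof.
by move=> a0 ab; rewrite lerD2l ler_wpM2l// powRN_nonincreasing.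
Qed.

(** Log-convexity in the form that [k (x + h) / k x] increases with [x], denominators cleared. For
    the pure power it reduces to $a(b+h) \le (a+h)b$; adding the constant 1 preserves it. *)
Lemma rs_kernel_log_convex (a b h : R) : 0 < a -> a <= b -> 0 <= h ->
  rs_kernel (a + h) * rs_kernel b <= rs_kernel a * rs_kernel (b + h).
Proof.
move=> a0 ab h0; rewrite /rs_kernel.
have b0 := lt_le_trans a0 ab.
have ah0 : 0 < a + h by rewrite ltr_wpDr.
have bh0 : 0 < b + h by rewrite ltr_wpDr.
have X := powRN_nonincreasing a0 (ltac:(lra) : a <= a + h).
have Y := powRN_nonincreasing a0 ab.
have XYAB : (a + h) `^ (- alpha) * b `^ (- alpha) <=
    a `^ (- alpha) * (b + h) `^ (- alpha).
  rewrite -!powRM ?(ltW a0) ?(ltW b0) ?(ltW ah0) ?(ltW bh0)//; apply: powRN_nonincreasing; first exact: mulr_gt0.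
  by nra.
have A0 : 0 < a `^ (- alpha) by exact: powR_gt0.
move: (a `^ _) ((a + h) `^ _) (b `^ _) ((b + h) `^ _) A0 X Y XYAB => A X Y B A0 XA YA XYAB.
(* From [0 <= (A - X)(A - Y)] and [XY <= AB]. *)
have XY : X + Y <= A + B by rewrite -(ler_pM2l A0); nra.
by have := ler_wpM2l c0 XY; have := ler_wpM2l (sqr_ge0 c) XYAB; nra.
Qed.

Lemma integral_powRN_itvcc (a b : R) : 0 < a -> a < b ->
  (\int[mu]_(x in `[a, b]) (x `^ (- alpha))%:E =
   ((b `^ (1 - alpha) - a `^ (1 - alpha)) / (1 - alpha))%:E)%E.
Proof.
move=> a0 ab.
have a1 : 1 - alpha != 0 by rewrite gt_eqF// subr_gt0.
have cont (x : R) e : 0 < x -> {for x, continuous (@powR R ^~ e)}.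
  move=> x0; apply: differentiable_continuous; apply/derivable1_diffP.
  by apply: derivable_powR; rewrite in_itv/= x0.
rewrite (@continuous_FTC2 _ _ (fun x => (1 - alpha)^-1 * x `^ (1 - alpha)))//.
- by rewrite -EFinB -mulrBr mulrC.
- apply/continuous_in_subspaceT => x /set_mem/=; rewrite in_itv/= => /andP[ax _].
  by apply: cont; exact: lt_le_trans ax.
- split.
  + move=> x; rewrite in_itv/= => /andP[ax _]; apply: derivableM => //.
    by apply: derivable_powR; rewrite in_itv/= (lt_trans a0).
  + apply: cvg_at_right_filter; apply: cvgM; first exact: cvg_cst.
    exact: cont.
  + apply: cvg_at_left_filter; apply: cvgM; first exact: cvg_cst.
    by apply: cont; exact: lt_trans ab.
- move=> x; rewrite in_itv/= => /andP[ax _].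
  have x0 := lt_trans a0 ax.
  rewrite derive1E deriveZ//=; last by apply: derivable_powR; rewrite in_itv/= x0.
  rewrite -derive1E powR_derive1 ?in_itv/= ?x0// /GRing.scale/= mulrA mulVf// mul1r.
  by congr (_ `^ _); lra.
Qed.

(** Monotone convergence along the intervals [[b / (i + 2), b]], where the primitive is
    available. *)
Lemma integral_powRN_le (b : R) : 0 < b ->
  (\int[mu]_(x in `[0%R, b]) (x `^ (- alpha))%:E <=
   (b `^ (1 - alpha) / (1 - alpha))%:E)%E.
Proof.
move=> b0.
have mp (D : set R) : measurable_fun D (fun x : R => (x `^ (- alpha))%:E).
  by apply: measurable_funTS; apply/measurable_EFinP; exact: measurable_powR.
rewrite -integral_itv_obnd_cbnd//.
(* Starting at 2 makes every interval nondegenerate, as [integral_powRN_itvcc] requires. *)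
pose F (i : nat) := `[b / i.+2%:R, b]%classic.
have FU : `]0, b]%classic = \bigcup_i F i.
  apply/seteqP; split => [x|x [i _]]; rewrite /F/= !in_itv/= => /andP[xa xb].
    exists (Num.truncn (b / x)) => //=; rewrite in_itv/= xb andbT.
    rewrite ler_pdivrMr// mulrC -ler_pdivrMr// ltW//.
    by rewrite (lt_le_trans (truncnS_gt _))// ler_nat.
  by rewrite xb andbT (lt_le_trans _ xa)// divr_gt0.
have ndF : nondecreasing_seq F.
  apply/nondecreasing_seqP => i; rewrite subsetEset => x.
  rewrite /F/= !in_itv/= => /andP[xa ->]; rewrite andbT (le_trans _ xa)//.
  by rewrite ler_pM2l// lef_pV2 ?posrE// ler_nat.
have f0 i (x : R) : F i x -> (0 <= (x `^ (- alpha))%:E)%E.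
  by move=> _; rewrite lee_fin powR_ge0.
have mF i : measurable (F i) by exact: measurable_itv.
have cv := @ge0_nondecreasing_set_cvg_integral _ (measurableTypeR R) R F
  (fun x : R => (x `^ (- alpha))%:E) [the measure _ _ of mu] ndF mF
  (fun i => mp (F i)) f0.
rewrite FU -(cvg_lim _ cv)//; apply: lime_le; first by apply/cvg_ex; eexists; exact: cv.
apply: nearW => i; rewrite integral_powRN_itvcc ?divr_gt0//; last first.
  by rewrite ltr_pdivrMr// ltr_pMr// ltr1n.
by rewrite lee_fin ler_pM2r ?invr_gt0 ?subr_gt0// gerBl powR_ge0.
Qed.

Lemma integrable_powRN (b : R) :
  mu.-integrable `[0, b] (EFin \o (fun x : R => x `^ (- alpha))).
Proof.
apply/integrableP; split.
  by apply/measurable_EFinP/measurable_funTS; exact: measurable_powR.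
under eq_integral do rewrite /= ger0_norm ?powR_ge0//.
have [b0|b0] := ltP 0 b.
  by apply: le_lt_trans (integral_powRN_le b0) _; rewrite ltry.
apply: (@le_lt_trans _ _ (\int[mu]_(x in [set 0%R]) (x `^ (- alpha))%:E)%E).
  apply: ge0_subset_integral => //.
  - by apply/measurable_EFinP/measurable_funTS; exact: measurable_powR.
  - by move=> x _; rewrite lee_fin powR_ge0.
  - by move=> x /=; rewrite in_itv/=; lra.
by rewrite integral_set1.
Qed.

Lemma integrable_cst_itvcc (a b r : R) : mu.-integrable `[a, b] (EFin \o (fun=> r)).
Proof.
apply: measurable_bounded_integrable => //; last exact: bounded_cst.
rewrite /= lebesgue_measure_itv/=.
by case: ifP => _; rewrite -?EFinB ltry.
Qed.

Lemma integrable_rs_kernel (b : R) : mu.-integrable `[0, b] (EFin \o rs_kernel).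
Proof.
have -> : EFin \o rs_kernel =
    ((EFin \o fun=> 1%R) \+ (fun x => c%:E * (x `^ (- alpha))%:E))%E.
  by apply/funext => x /=; rewrite -EFinM -EFinD.
apply: integrableD => //; first exact: integrable_cst_itvcc.
by apply: integrableZl => //; exact: integrable_powRN.
Qed.

(** The mass on [[0, b]] is at most $b + c\,b^{1-\alpha}/(1-\alpha)$, which vanishes with $b$
    because $\alpha < 1$. *)
Lemma rs_kernel_small (e : R) : 0 < e ->
  \forall b \near 0^'+, \int[mu]_(x in `[0, b]) rs_kernel x < e.
Proof.
move=> e0.
suff : \forall b \near 0^'+, b + c * (b `^ (1 - alpha) / (1 - alpha)) < e.
  move=> H; near=> b.
  have b0 : 0 < b by [].
  apply: (le_lt_trans _ (_ : b + c * (b `^ (1 - alpha) / (1 - alpha)) < e)); last by near: b.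
  rewrite RintegralD//; last 2 first.
  - exact: integrable_cst_itvcc.
  - by have := @integrableZl _ _ _ mu _ (measurable_itv `[0, b]) c _ (integrable_powRN b).
  rewrite Rintegral_cst// mul1r /= lebesgue_measure_itv/= lte_fin b0 -EFinB/= subr0.
  rewrite lerD2l RintegralZl//; last exact: integrable_powRN.
  rewrite ler_wpM2l//.
  rewrite -lee_fin fineK; first exact: integral_powRN_le.
  exact: integrable_fin_num (integrable_powRN b).
have cvg0 : b + c * (b `^ (1 - alpha) / (1 - alpha)) @[b --> 0^'+] --> 0 + c * (0 / (1 - alpha)).
  apply: cvgD; first exact: cvg_at_right_filter.
  apply: cvgM; first exact: cvg_cst.
  apply: cvgM; last exact: cvg_cst.
  by apply: powR_cvg0; rewrite subr_gt0.
by apply: (cvgr_lt _ cvg0); rewrite mul0r mulr0 addr0.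
Unshelve. all: end_near. Qed.

End rayleigh_stokes_kernel.


(** * Positivity for the Volterra equation *)

Section volterra.
Context (R : realType).
Notation mu := (@lebesgue_measure R).
Variables (c alpha : R).
Hypotheses (c0 : 0 <= c) (alpha0 : 0 < alpha) (alpha1 : alpha < 1).
Notation k := (rs_kernel c alpha).

Lemma measurable_rs_kernel_refl t (D : set R) : measurable_fun D (fun s => k (t - s)).
Proof.
apply: measurable_funTS.
apply: (@measurableT_comp _ _ _ _ _ _ k) => //; first exact: measurable_rs_kernel.
exact: measurable_reflection.
Qed.

Lemma integrable_rs_kernel_refl t :
  mu.-integrable `[0, t] (EFin \o (fun s => k (t - s))).
Proof.
have kpos s : 0 <= k s by rewrite ltW// rs_kernel_gt0.
apply/integrableP; split.
  by apply/measurable_EFinP; exact: measurable_rs_kernel_refl.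
have /integrableP[_] := integrable_rs_kernel c alpha1 t.
under eq_integral do rewrite /= ger0_norm//.
rewrite (ge0_integral_reflection t)//; last first.
  by apply: measurable_funTS; exact: measurable_rs_kernel.
under [X in _ -> (X < _)%E]eq_integral do rewrite /= ger0_norm//.
congr (integral _ _ _ < _)%E; apply/seteqP; split => x /=; rewrite !in_itv/=; lra.
Qed.

Lemma continuous_bounded_itvcc (w : R -> R) (a b : R) : continuous w ->
  [bounded w x | x in `[a, b]].
Proof.
move=> cw; have cwab : {within `[a, b], continuous w} by exact: continuous_subspaceT.
have /compact_bounded[M [Mr MP]] := continuous_compact cwab (@segment_compact _ a b).
by exists M; split => // x Mx y aby; apply: MP => //; exists y.
Qed.

Lemma integrable_rs_kernel_conv (w : R -> R) t : continuous w ->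
  mu.-integrable `[0, t] (EFin \o (fun s => k (t - s) * w s)).
Proof.
move=> cw.
have -> : EFin \o (fun s => k (t - s) * w s) =
    ((EFin \o w) \* (EFin \o (fun s => k (t - s))))%E.
  by apply/funext => s /=; rewrite -EFinM mulrC.
apply: integrableMr => //.
- by apply: measurable_funTS; exact: continuous_measurable_fun.
- exact: continuous_bounded_itvcc.
- exact: integrable_rs_kernel_refl.
Qed.

(** The interval is open at [t] so that the kernel is evaluated at positive arguments only. *)
Definition rs_conv (w : R -> R) (t : R) : R :=
  \int[mu]_(s in `[0, t[) (k (t - s) * w s).

Lemma Rintegral_rs_kernel_tail (a b : R) : a < b ->
  \int[mu]_(s in `[a, b[) k (b - s) = \int[mu]_(s in `[0, b - a]) k s.
Proof.
move=> ab; rewrite -[RHS]Rintegral_itv_obnd_cbnd; last first.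
  apply: integrableS (integrable_rs_kernel c alpha1 (b - a)) => //.
  by move=> x /=; rewrite !in_itv/=; lra.
congr fine; rewrite [RHS](ge0_integral_reflection b); last 3 first.
- exact: measurable_itv.
- by apply: measurable_funTS; exact: measurable_rs_kernel.
- by move=> x _; rewrite ltW// rs_kernel_gt0.
by congr (integral _ _ _); apply/seteqP; split => x /=; rewrite !in_itv/=; lra.
Qed.

Lemma Rintegral_itvco_split (f : R -> R) (a b d : R) : a <= b -> b <= d ->
  mu.-integrable `[a, d] (EFin \o f) ->
  \int[mu]_(s in `[a, d[) f s = \int[mu]_(s in `[a, b[) f s + \int[mu]_(s in `[b, d[) f s.
Proof.
move=> ab bd intf.
have U : `[a, d[%classic = `[a, b[%classic `|` `[b, d[%classic :> set R.
  by rewrite -itv_bndbnd_setU// bnd_simp.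
rewrite U Rintegral_setU//.
- by rewrite -U; apply: integrableS intf => // x /=; rewrite !in_itv/=; lra.
- by apply/disj_setPS => x [/=]; rewrite !in_itv/=; lra.
Qed.

Lemma le_Rintegral_scale (D : set R) (f g : R -> R) (a b : R) : measurable D ->
  mu.-integrable D (EFin \o f) -> mu.-integrable D (EFin \o g) ->
  (forall x, D x -> f x * a <= g x * b) ->
  (\int[mu]_(x in D) f x) * a <= (\int[mu]_(x in D) g x) * b.
Proof.
move=> mD fi gi fg; rewrite -RintegralZr// -RintegralZr//.
apply: le_Rintegral => //.
- exact: (@integrableZr _ _ _ mu _ mD a _ fi).
- exact: (@integrableZr _ _ _ mu _ mD b _ gi).
Qed.

(* [t1] is the first point where [w <= 0]; [t] maximizes [w] just before [t1], so
   that the part of the convolution over [[t, t1]] is at most [w t] times the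
   small mass of the kernel near [0]. *)
Lemma volterra_positive (m : R) (w F : R -> R) :
  0 < m -> continuous w -> 0 < w 0 ->
  (forall t, 0 < t -> w t + m * rs_conv w t = F t) ->
  (forall s t, 0 < s -> s <= t -> F s * k t <= F t * k s) ->
  forall t, 0 <= t -> 0 < w t.
Proof.
move=> m0 cw w0 wF Fk T T0; rewrite ltNge; apply/negP => wT.
pose A := `[0, T]%classic `&` w @^-1` [set y | y <= 0].
have cA : compact A.
  apply: compact_closedI; first exact: segment_compact.
  by apply: closed_comp => [x _|]; [exact: cw|exact: closed_le].
have A0 : A !=set0 by exists T; split => //=; rewrite in_itv/= lexx T0.
have [t1 /set_mem[]] : exists2 t1, t1 \in A & forall t, t \in A -> t1 <= t.
  apply: (@compact_EVT_min _ _ idfun) => //.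
  by apply: continuous_subspaceT => x; exact: cvg_id.
rewrite /= in_itv/= => /andP[t10 t1T] wt1 t1min.
have wpos t : 0 <= t -> t < t1 -> 0 < w t.
  move=> t0 tt1; rewrite ltNge; apply/negP => wt.
  have : t \in A by apply/mem_set; split => //=; rewrite in_itv/= t0 (ltW (lt_le_trans tt1 _)).
  by move=> /t1min/=; rewrite leNgt tt1.
have {}t10 : 0 < t1.
  by rewrite lt_neqAle t10 andbT; apply: contraTneq wt1 => <-; rewrite -ltNge.
have kpos t : 0 < k t by exact: rs_kernel_gt0.
(* With kernel mass [K] below this threshold, [m * K * k t < k t1] for all [t >= t1 / 2]; this is
   what the final contradiction needs. Accordingly [de] is below [dl] and at most [t1 / 2]. *)
have e0 : 0 < k t1 / (m * k (t1 / 2)) by rewrite divr_gt0// mulr_gt0.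
have [dl /= dl0 dlP] := rs_kernel_small c0 alpha1 e0.
pose de := Num.min (dl / 2) (t1 / 2).
have de0 : 0 < de by rewrite lt_min !divr_gt0.
have det1 : de <= t1 / 2 by rewrite ge_min lexx orbT.
have dedl : de < dl by rewrite (@le_lt_trans _ _ (dl / 2))// ?ge_min ?lexx//; lra.
have [t] := @EVT_max R w (t1 - de) t1 (ltac:(lra))
  (continuous_subspaceT cw).
rewrite in_itv/= => /andP[t1t tt1] tmax.
have wt : 0 < w t.
  apply: (@lt_le_trans _ _ (w (t1 - de))); first by apply: wpos; lra.
  by apply: tmax; rewrite in_itv/=; lra.
have {}tt1 : t < t1.
  by rewrite lt_neqAle tt1 andbT; apply: contraTneq wt => ->; rewrite -leNgt.
have t0 : 0 < t by lra.
have ft := Fk _ _ t0 (ltW tt1).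
have := wF _ t10; rewrite /rs_conv.
rewrite (Rintegral_itvco_split (ltW t0) (ltW tt1)); last exact: integrable_rs_kernel_conv.
set I1 := \int[mu]_(s in `[0, t[) _.
set I2 := \int[mu]_(s in `[t, t1[) _ => eF1.
(* Log-convexity gives [k (t1 - s) * k t <= k t1 * k (t - s)], and [w s > 0] on [[0, t[]. *)
have I1le : I1 * k t <= k t1 * rs_conv w t.
  have i1 (u : R) : t <= u -> mu.-integrable `[0, t[ (EFin \o (fun s => k (u - s) * w s)).
    move=> tu; apply: integrableS (integrable_rs_kernel_conv u cw) => //.
    by move=> x/=; rewrite !in_itv/=; lra.
  rewrite [k t1 * _]mulrC; apply: le_Rintegral_scale (i1 _ (ltW tt1)) (i1 _ (lexx _)) _ => //.
  move=> s /=; rewrite in_itv/= => /andP[s0 st].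
    have ws : 0 < w s by apply: wpos => //; exact: lt_trans tt1.
    rewrite mulrAC [leRHS]mulrAC ler_pM2r//.
    have := @rs_kernel_log_convex _ _ _ c0 alpha0 (t - s) t (t1 - t).
    rewrite [t - s + (t1 - t)](_ : _ = t1 - s); last by lra.
    rewrite [t + (t1 - t)](_ : _ = t1); last by lra.
    by apply; lra.
have I2le : I2 <= w t * \int[mu]_(s in `[0, t1 - t]) k s.
  rewrite -Rintegral_rs_kernel_tail//.
  have i2 : mu.-integrable `[t, t1[ (EFin \o (fun s => k (t1 - s))).
    apply: integrableS (integrable_rs_kernel_refl t1) => //.
    by move=> x/=; rewrite !in_itv/=; lra.
  rewrite -RintegralZl//; apply: le_Rintegral => //.
  - apply: integrableS (integrable_rs_kernel_conv t1 cw) => //.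
    by move=> x/=; rewrite !in_itv/=; lra.
  - have := @integrableZl _ _ _ mu _ (measurable_itv `[t, t1[) (w t) _ i2.
    by apply: eq_integrable.
  - move=> s /=; rewrite in_itv/= => /andP[ts st1].
    by rewrite mulrC ler_pM2r// tmax// in_itv/=; lra.
have Klt : \int[mu]_(s in `[0, t1 - t]) k s < k t1 / (m * k (t1 / 2)).
  apply: dlP; last by rewrite subr_gt0.
  by rewrite /= sub0r normrN gtr0_norm ?subr_gt0//; lra.
have kt : k t <= k (t1 / 2) by apply: rs_kernel_nonincreasing => //; lra.
move: Klt I2le; set K := \int[mu]_(_ in _) _ => Klt I2le.
have {}Klt : m * K * k (t1 / 2) < k t1.
  by rewrite mulrAC mulrC -ltr_pdivlMr ?mulr_gt0.
have K0 : 0 <= K by apply: Rintegral_ge0 => s _; rewrite ltW.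
have h1 : m * K * k t <= m * K * k (t1 / 2) by rewrite ler_wpM2l// mulr_ge0// ltW.
have := wF _ t0; move: (rs_conv w t) I1le => V I1le eF.
have h2 : I2 * k t <= w t * K * k t by rewrite ler_wpM2r// ltW.
have h3 : m * ((I1 + I2) * k t) <= m * (k t1 * V + w t * K * k t).
  by rewrite ler_wpM2l ?(ltW m0)// mulrDl lerD.
(* Since [w t1 <= 0], [F t1] is at most [m * (I1 + I2)]. In [F t * k t1 <= F t1 * k t] the terms
   [m * V * k t1] then cancel, leaving a contradiction with the choice of the threshold. *)
have h4 : w t * k t1 <= w t * (m * K * k t).
  have : F t1 * k t <= m * ((I1 + I2) * k t).
    by rewrite mulrA ler_wpM2r ?(ltW (kpos t))// -eF1 gerDr.
  move=> /(le_trans ft); rewrite -eF => h; have := le_trans h h3; nra.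
by move: h4; rewrite ler_pM2l//; lra.
Qed.

End volterra.


(** * Monotonicity, integral bound and decay of the relaxation functions *)

Section volterra_relaxation.
Context (R : realType).
Notation mu := (@lebesgue_measure R).
Variables (c alpha : R).
Hypotheses (c0 : 0 <= c) (alpha0 : 0 < alpha) (alpha1 : alpha < 1).
Notation k := (rs_kernel c alpha).
Notation conv := (rs_conv c alpha).
Implicit Types (m : R) (w : R -> R).

(** Continuity is required on the whole line; functions given on [[0, +oo[] are extended evenly. *)
Definition volterra_solution m w := [/\ continuous w, w 0 = 1 &
  forall t, 0 < t -> w t + m * conv w t = 1].

Let k_ge0 t : 0 <= k t. Proof. exact/ltW/rs_kernel_gt0. Qed.

Lemma integrable_rs_kernel_convS w t (D : set R) : continuous w -> measurable D ->
  D `<=` `[0, t]%classic ->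
  mu.-integrable D (EFin \o (fun s => k (t - s) * w s)).
Proof.
move=> cw mD Dt.
exact: integrableS (integrable_rs_kernel_conv c0 alpha1 t cw).
Qed.

Lemma rs_conv_lin (a b : R) w v t : continuous w -> continuous v ->
  conv (fun s => a * w s + b * v s) t = a * conv w t + b * conv v t.
Proof.
move=> cw cv; have sub : `[0, t[%classic `<=` `[0, t]%classic.
  by move=> x /=; rewrite !in_itv/=; lra.
have iw := integrable_rs_kernel_convS cw (measurable_itv _) sub.
have iv := integrable_rs_kernel_convS cv (measurable_itv _) sub.
rewrite /rs_conv -RintegralZl// -RintegralZl// -RintegralD//.
- by apply: eq_Rintegral => s _; ring.
- exact: (@integrableZl _ _ _ mu _ (measurable_itv `[0, t[) a _ iw).
- exact: (@integrableZl _ _ _ mu _ (measurable_itv `[0, t[) b _ iv).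
Qed.

Lemma rs_conv_ge0 w t : (forall s, 0 <= s -> 0 <= w s) -> 0 <= conv w t.
Proof.
move=> w0; apply: Rintegral_ge0 => s /=; rewrite in_itv/= => /andP[s0 _].
by rewrite mulr_ge0// w0.
Qed.

(** Splitting the history at [h] shows that [w (. + h)] solves the same equation, with the integral
    over [[0, h[] moved to the right-hand side. *)
Lemma rs_conv_translation w (t h : R) : continuous w -> (forall s, 0 <= s -> 0 <= w s) ->
  0 <= t -> 0 <= h ->
  conv w (t + h) = \int[mu]_(s in `[0, h[) (k (t + h - s) * w s) +
                   conv (fun s => w (s + h)) t.
Proof.
move=> cw w0 t0 h0; rewrite /rs_conv (@Rintegral_itvco_split _ _ 0 h)//; last 2 first.
- by rewrite lerDr.
- exact: integrable_rs_kernel_conv.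
congr (_ + _); congr fine; rewrite [LHS](ge0_integral_translation h).
- have -> : [set x | `[h, (t + h)%R[%classic (x + h)] = `[0, t[%classic.
    by apply/seteqP; split => x /=; rewrite !in_itv/=; lra.
  by apply: eq_integral => s _; rewrite (_ : t + h - (s + h) = t - s)//; ring.
- exact: measurable_itv.
- apply: measurable_funM; first exact: measurable_rs_kernel_refl.
  by apply: measurable_funTS; exact: continuous_measurable_fun.
- move=> x /=; rewrite in_itv/= => /andP[hx _].
  by rewrite mulr_ge0// w0// (le_trans h0).
Qed.

(** Here [F = 1], and [1 / k] is nondecreasing because [k] is nonincreasing. *)
Lemma volterra_solution_gt0 m w : 0 < m -> volterra_solution m w ->
  forall t, 0 <= t -> 0 < w t.
Proof.
move=> m0 [cw w0 wE].
apply: (volterra_positive c0 alpha0 alpha1 m0 cw _ wE); first by rewrite w0.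
by move=> s t s0 st; rewrite !mul1r rs_kernel_nonincreasing.
Qed.

Lemma volterra_solution_le1 m w t : 0 < m -> volterra_solution m w ->
  0 <= t -> w t <= 1.
Proof.
move=> m0 wsol; have wpos := volterra_solution_gt0 m0 wsol.
have [cw w0 wE] := wsol.
rewrite le_eqVlt => /predU1P[<-|t0]; first by rewrite w0.
rewrite -(wE _ t0) lerDl mulr_ge0 ?(ltW m0)//; apply: rs_conv_ge0 => s /wpos.
exact: ltW.
Qed.

(* The strict positivity result is applied to [w - w(. + h) + eps w], the last
   term making the initial value positive. *)
Lemma volterra_solution_nonincreasing m w (a b : R) : 0 < m ->
  volterra_solution m w -> 0 <= a -> a <= b -> w b <= w a.
Proof.
move=> m0 wsol a0; have wpos := volterra_solution_gt0 m0 wsol.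
have wge0 s : 0 <= s -> 0 <= w s by move=> /wpos/ltW.
have [cw w0 wE] := wsol.
rewrite le_eqVlt => /predU1P[->//|ab].
have [h h0 ->] : exists2 h, 0 < h & b = a + h by exists (b - a); lra.
apply/ler_addgt0Pr => e e0.
have wa := wpos _ a0.
(* Chosen so that [v a = w a - w b + e] below. *)
pose eps := e / w a.
have eps0 : 0 < eps by rewrite divr_gt0.
have cwh : continuous (fun s => w (s + h)).
  move=> x; apply: (@continuous_comp _ _ _ (fun s => s + h) w); last exact: cw.
  by apply: cvgD; [exact: cvg_id|exact: cvg_cst].
pose v s := (1 + eps) * w s + (- 1) * w (s + h).
suff : 0 < v a by rewrite /v mulrDl /eps mul1r divfK ?gt_eqF//; lra.
pose I t := \int[mu]_(s in `[0, h[) (k (t + h - s) * w s).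
have intI t : 0 < t -> mu.-integrable `[0, h[ (EFin \o (fun s => k (t + h - s) * w s)).
  move=> t0; apply: integrable_rs_kernel_convS => // x /=.
  by rewrite !in_itv/=; lra.
(* The right-hand side of the equation for [v]: [eps / k] is nondecreasing by monotonicity of [k],
   and [I / k] by log-convexity. *)
apply: (@volterra_positive _ _ _ c0 alpha0 alpha1 m v (fun t => eps + m * I t)) => //.
- by move=> x; apply: cvgD; apply: cvgM; [exact: cvg_cst|exact: cw|exact: cvg_cst|exact: cwh].
- rewrite /v w0 add0r; have := volterra_solution_le1 m0 wsol (ltW h0); lra.
- move=> t t0; rewrite rs_conv_lin//.
  have e1 := wE _ t0.
  have e2 := wE _ (addr_gt0 t0 h0).
  rewrite (rs_conv_translation cw wge0 (ltW t0) (ltW h0)) -/(I t) in e2.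
  rewrite /v; move: (conv (fun s => w (s + h)) t) (conv w t) e1 e2 => B A e1 e2.
  have -> : w t = 1 - m * A by lra.
  have -> : w (t + h) = 1 - m * (I t + B) by lra.
  by ring.
- move=> s t s0 st; have t0 := lt_le_trans s0 st.
  have kle : k t <= k s by exact: rs_kernel_nonincreasing.
  have Ile : I s * k t <= I t * k s.
    apply: le_Rintegral_scale (intI _ s0) (intI _ t0) _ => //.
    move=> x /=; rewrite in_itv/= => /andP[x0 xh].
    rewrite mulrAC [leRHS]mulrAC ler_wpM2r ?wge0//.
    rewrite -!addrA mulrC [leRHS]mulrC [leLHS]mulrC.
    by apply: rs_kernel_log_convex => //; lra.
  move: (I s) (I t) (k s) (k t) Ile kle => Is It ks kt Ile kle.
  rewrite !mulrDl; apply: lerD; first by rewrite ler_wpM2l// ltW.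
  by rewrite -!mulrA ler_wpM2l// ltW.
Qed.

(** The difference [w1 - w2] solves the equation with coefficient [m1] and right-hand side
    [(1 - m1 / m2) * (1 - w2)], which is nonnegative and nondecreasing. Adding [eps * w1] makes the
    initial value positive. *)
Lemma volterra_solution_le_coef (m1 m2 : R) w1 w2 t : 0 < m1 -> m1 <= m2 ->
  volterra_solution m1 w1 -> volterra_solution m2 w2 -> 0 <= t -> w2 t <= w1 t.
Proof.
move=> m10 m12 sol1 sol2 t0; have m20 := lt_le_trans m10 m12.
have [cw1 w10 w1E] := sol1; have [cw2 w20 w2E] := sol2.
apply/ler_addgt0Pr => e e0.
have w1t := volterra_solution_gt0 m10 sol1 t0.
pose eps := e / w1 t.
have eps0 : 0 < eps by rewrite divr_gt0.
pose v s := (1 + eps) * w1 s + (- 1) * w2 s.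
suff : 0 < v t by rewrite /v mulrDl /eps mul1r divfK ?gt_eqF//; lra.
have q0 : 0 <= 1 - m1 / m2 by rewrite subr_ge0 ler_pdivrMr// mul1r.
apply: (@volterra_positive _ _ _ c0 alpha0 alpha1 m1 v
  (fun t => eps + (1 - m1 / m2) * (1 - w2 t))) => //.
- by move=> x; apply: cvgD; apply: cvgM; [exact: cvg_cst|exact: cw1|exact: cvg_cst|exact: cw2].
- by rewrite /v w10 w20; lra.
- move=> s s0; rewrite rs_conv_lin// /v.
  have e1 := w1E _ s0; have e2 := w2E _ s0.
  move: (conv w1 s) (conv w2 s) e1 e2 => A B e1 e2.
  have -> : w1 s = 1 - m1 * A by lra.
  have -> : w2 s = 1 - m2 * B by lra.
  by field; rewrite gt_eqF.
- move=> s r s0 sr; have r0 := lt_le_trans s0 sr.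
  apply: ler_pM => //.
  + by rewrite addr_ge0 ?(ltW eps0)// mulr_ge0// subr_ge0 (volterra_solution_le1 m20 sol2)// ltW.
  + rewrite lerD2l ler_wpM2l// lerD2l lerN2.
    by apply: (volterra_solution_nonincreasing m20 sol2) => //; exact: ltW.
  + exact: rs_kernel_nonincreasing.
Qed.

(** As [k >= 1], the integral of [w] is at most the convolution, which equals [(1 - w t) / m]. *)
Lemma volterra_solution_integral_le m w t : 0 < m -> volterra_solution m w -> 0 <= t ->
  (\int[mu]_(s in `[0%R, t]) (w (t - s)%R)%:E <= (m^-1)%:E)%E.
Proof.
move=> m0 wsol; have wpos := volterra_solution_gt0 m0 wsol.
have wge0 s : 0 <= s -> 0 <= w s by move=> /wpos/ltW.
have [cw w0 wE] := wsol.
have mw (D : set R) : measurable_fun D w.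
  by apply: measurable_funTS; exact: continuous_measurable_fun.
rewrite le_eqVlt => /predU1P[<-|t0].
  by rewrite set_itv1 integral_set1 lee_fin invr_ge0 ltW.
have -> : (\int[mu]_(s in `[0%R, t]) (w (t - s)%R)%:E = \int[mu]_(s in `[0%R, t]) (w s)%:E)%E.
  rewrite [RHS](ge0_integral_reflection t)//.
    by congr (integral _ _ _); apply/seteqP; split => x /=; rewrite !in_itv/=; lra.
  by move=> x /=; rewrite in_itv/= => /andP[/wge0].
have mkw : measurable_fun `[0, t] (fun s => k (t - s) * w s).
  by apply: measurable_funM => //; exact: measurable_rs_kernel_refl.
apply: (@le_trans _ _ (\int[mu]_(s in `[0%R, t]) (k (t - s) * w s)%:E)%E).
  apply: ge0_le_integral => //.
  - by move=> s /=; rewrite in_itv/= lee_fin => /andP[/wge0].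
  - by apply/measurable_EFinP; exact: mw.
  - by apply/measurable_EFinP; exact: mkw.
  - move=> s /=; rewrite in_itv/= lee_fin => /andP[/wge0 ws _].
    by rewrite ler_peMl// rs_kernel_ge1.
have iw := integrable_rs_kernel_conv c0 alpha1 t cw.
have ifin : (\int[mu]_(s in `[0%R, t]) (k (t - s) * w s)%:E)%E \is a fin_num.
  exact: integrable_fin_num iw.
rewrite -(fineK ifin) lee_fin.
have := wE _ t0; rewrite /rs_conv Rintegral_itv_bndo_bndc; last first.
  apply: integrable_rs_kernel_convS => //.
  by move=> x /=; rewrite !in_itv/=; lra.
rewrite /Rintegral => e1.
rewrite -[leRHS]mul1r ler_pdivlMr// mulrC -e1 lerDr.
by rewrite wge0// ltW.
Qed.

(** By monotonicity [t * w t] is at most the integral of [w] over [[0, t]]. *)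
Lemma volterra_solution_decay m w t : 0 < m -> volterra_solution m w -> 0 < t ->
  w t <= (m * t)^-1.
Proof.
move=> m0 wsol t0.
have cw : continuous w by have [] := wsol.
have wpos := volterra_solution_gt0 m0 wsol.
have : (\int[mu]_(s in `[0%R, t]) (w t)%:E <= (m^-1)%:E)%E.
  apply: le_trans (volterra_solution_integral_le m0 wsol (ltW t0)).
  apply: ge0_le_integral => //.
  - by move=> s _; rewrite lee_fin ltW// wpos// ltW.
  - apply/measurable_EFinP; apply: measurable_funTS.
    apply: (@measurableT_comp _ _ _ _ _ _ w); first exact: continuous_measurable_fun.
    exact: measurable_reflection.
  - move=> s /=; rewrite in_itv/= lee_fin => /andP[s0 st].
    by apply: (volterra_solution_nonincreasing m0 wsol); lra.
rewrite integral_cst//= lebesgue_measure_itv/= lte_fin t0 -EFinB -EFinM lee_fin subr0.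
by rewrite -ler_pdivlMr// -invfM.
Qed.

End volterra_relaxation.


(** * From the fractional differential equation to the Volterra equation *)

Section relaxation_to_volterra.
Context (R : realType).
Notation mu := (@lebesgue_measure R).
Variables (gamma alpha : R).
Hypotheses (gamma0 : 0 < gamma) (alpha0 : 0 < alpha) (alpha1 : alpha < 1).

(* If the integral defining [Gamma (1 - alpha)] were infinite, [Gamma] and this
   quotient would be [0]; only the sign matters below. *)
Definition relaxation_coef : R := gamma / Gamma (1 - alpha).
Notation c := relaxation_coef.

Lemma relaxation_coef_ge0 : 0 <= c.
Proof.
rewrite divr_ge0 ?(ltW gamma0)//; apply: Rintegral_ge0 => x _.
by rewrite mulr_ge0 ?powR_ge0 ?expR_ge0.
Qed.

Lemma continuous_even_extension (w : R -> R) : {within `[0, +oo[, continuous w} ->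
  continuous (fun t : R => w `|t|).
Proof.
move=> /subspace_continuousP cw x.
apply: (@cvg_comp _ _ _ (fun t : R => `|t|) w _ (within `[0, +oo[ (nbhs `|x|))).
  move=> P nP; have : \forall y \near x, `[0, +oo[%classic `|y| -> P `|y|.
    exact: (@norm_continuous _ R x _ nP).
  by apply: filterS => y; apply; rewrite /= in_itv/= normr_ge0.
by apply: cw; rewrite /= in_itv/= normr_ge0.
Qed.

Lemma rl_convolutionE (w : R -> R) t : continuous (fun s : R => w `|s|) ->
  \int[mu]_(s in `[0, t]) w `|s| + gamma * rl_convolution alpha w t =
  rs_conv c alpha (fun s : R => w `|s|) t.
Proof.
move=> cw.
have iw : mu.-integrable `[0, t] (EFin \o (fun s : R => w `|s|)).
  apply: continuous_compact_integrable; first exact: segment_compact.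
  exact: continuous_subspaceT.
have ig : mu.-integrable `[0, t] (EFin \o (fun s => (t - s) `^ (- alpha) * w `|s|)).
  (* The power part is the kernel with coefficient 1 minus the constant 1; this avoids dividing by
     [c], which is only known to be nonnegative. *)
  have ik := integrable_rs_kernel_conv (ler01 : 0 <= 1 :> R) alpha1 t cw.
  have -> : EFin \o (fun s => (t - s) `^ (- alpha) * w `|s|) =
      ((EFin \o (fun s : R => (rs_kernel 1 alpha (t - s) * w `|s|)%R)) \-
       (EFin \o (fun s : R => (w `|s|)%R)))%E.
    by apply/funext => s /=; rewrite -EFinB /rs_kernel; congr EFin; ring.
  exact: (@integrableB _ _ _ mu _ (measurable_itv `[0, t])).
have ic : mu.-integrable `[0, t] (EFin \o (fun s => c * ((t - s) `^ (- alpha) * w `|s|))).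
  exact: (@integrableZl _ _ _ mu _ (measurable_itv `[0, t]) c _ ig).
have -> : gamma * rl_convolution alpha w t =
    \int[mu]_(s in `[0, t]) (c * ((t - s) `^ (- alpha) * w `|s|)).
  rewrite RintegralZl// /c -mulrA; congr (_ * _).
  rewrite -RintegralZl//; apply: eq_Rintegral => s /set_mem/=.
  rewrite in_itv/= => /andP[s0 _].
  by rewrite /gker ger0_norm// (_ : 1 - alpha - 1 = - alpha); ring.
rewrite -RintegralD// /rs_conv Rintegral_itv_bndo_bndc.
  by apply: eq_Rintegral => s _; rewrite /rs_kernel; ring.
apply: integrable_rs_kernel_convS => //; first exact: relaxation_coef_ge0.
by move=> x /=; rewrite !in_itv/=; lra.
Qed.

(** Near 0 the function is bounded and the kernel has small mass. This determines the constant of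
    integration below. *)
Lemma rs_conv_small (w : R -> R) (e : R) : continuous w -> 0 < e ->
  \forall t \near 0^'+, `|rs_conv c alpha w t| < e.
Proof.
move=> cw e0.
have [M [Mr MP]] := @continuous_bounded_itvcc _ w 0 1 cw.
pose B := `|M| + 1.
have B0 : 0 < B by rewrite ltr_wpDl.
have wB s : 0 <= s <= 1 -> `|w s| <= B.
  by move=> s01; apply: (MP B) => //; rewrite /B (le_lt_trans (ler_norm M))// ltrDl.
have eB : 0 < e / B by rewrite divr_gt0.
near=> t.
have t0 : 0 < t by [].
have t1 : t <= 1 by near: t; apply: nbhs_right_le.
have ic : mu.-integrable `[0, t[ (EFin \o (fun s => rs_kernel c alpha (t - s) * w s)).
  apply: integrable_rs_kernel_convS => //; first exact: relaxation_coef_ge0.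
  by move=> x /=; rewrite !in_itv/=; lra.
have ik : mu.-integrable `[0, t[ (EFin \o (fun s => rs_kernel c alpha (t - s))).
  apply: integrableS (integrable_rs_kernel_refl relaxation_coef_ge0 alpha1 t) => //.
  by move=> x /=; rewrite !in_itv/=; lra.
apply: (le_lt_trans (le_normr_Rintegral _ ic)) => //.
apply: (@le_lt_trans _ _ (\int[mu]_(s in `[0, t[) (B * rs_kernel c alpha (t - s)))).
  apply: le_Rintegral => //.
  - exact: (integrable_norm ic).
  - exact: (@integrableZl _ _ _ mu _ (measurable_itv `[0, t[) B _ ik).
  - move=> s /=; rewrite in_itv/= => /andP[s0 st].
    have kpos := rs_kernel_gt0 alpha relaxation_coef_ge0 (t - s).
    rewrite normrM gtr0_norm// mulrC ler_pM2r// wB// s0/=.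
    by rewrite (le_trans (ltW st)).
rewrite RintegralZl// Rintegral_rs_kernel_tail//; last exact: relaxation_coef_ge0.
rewrite subr0 mulrC -ltr_pdivlMr//.
near: t; exact: (rs_kernel_small relaxation_coef_ge0 alpha1 eB).
Unshelve. all: end_near. Qed.

Lemma is_derive0_constant (H : R -> R) (a b : R) :
  (forall t : R, 0 < t -> is_derive t 1 H 0) -> 0 < a -> a < b -> H a = H b.
Proof.
move=> dH a0 ab.
have [||x _] := @MVT _ H (fun=> 0) a b ab.
- by move=> x; rewrite in_itv/= => /andP[ax _]; apply: dH; exact: lt_trans ax.
- apply: derivable_within_continuous => x; rewrite in_itv/= => /andP[ax _].
  by have := dH _ (lt_le_trans a0 ax); case.
by rewrite mul0r => /eqP; rewrite subr_eq0 => /eqP.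
Qed.

Lemma is_derive_lin_comb (u v w : R -> R) (a b t u' v' w' : R) :
  is_derive t 1 u u' -> is_derive t 1 v v' -> is_derive t 1 w w' ->
  is_derive t 1 (u + a *: (v + b *: w)) (u' + a * (v' + b * w')).
Proof.
move=> du dv dw.
exact: (is_deriveD du (is_deriveZ a (is_deriveD dv (is_deriveZ b dw)))).
Qed.

(** The differential equation says that [H] has zero derivative on []0, +oo[]. Its constant value is
    1, seen by letting [r] tend to 0, where [w] tends to 1 and the convolution to 0. *)
Lemma relaxation_volterra_solution m (w : R -> R) : 0 < m ->
  relaxation_solution gamma alpha m w ->
  volterra_solution c alpha m (fun t : R => w `|t|).
Proof.
move=> m0 [cw w0 weq]; have cW := continuous_even_extension cw.
split; [exact: cW|by rewrite normr0|].
pose A t := \int[mu]_(s in `[0, t]) w `|s|.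
pose J := rl_convolution alpha w.
pose H : R -> R := w + m *: (A + gamma *: J).
have HE (t : R) : 0 < t -> H t = w `|t| + m * rs_conv c alpha (fun s : R => w `|s|) t.
  by move=> t0; rewrite -rl_convolutionE// gtr0_norm.
have dH (t : R) : 0 < t -> is_derive t 1 H 0.
  move=> t0; have [dw dJ eq0] := weq _ t0.
  have iA : mu.-integrable `[0, t + 1] (EFin \o (fun s : R => w `|s|)).
    apply: continuous_compact_integrable; first exact: segment_compact.
    exact: continuous_subspaceT.
  have [dA A'] := continuous_FTC1_closed (ltr_pwDr ltr01 (lexx t)) iA t0 (cW t).
  have idw : is_derive t 1 w (derive1 w t) by exact: (DeriveDef dw (esym (derive1E w t))).
  have idJ : is_derive t 1 J (derive1 J t) by exact: (DeriveDef dJ (esym (derive1E J t))).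
  have idA : is_derive t 1 A (w t).
    by apply: (DeriveDef dA); rewrite -derive1E A' gtr0_norm.
  by rewrite -eq0; exact: is_derive_lin_comb.
move=> t t0; rewrite -HE//; apply/eqP; rewrite -subr_eq0 -normr_le0.
apply/ler_addgt0Pr => e e0; rewrite add0r.
have e20 : 0 < e / 2 by rewrite divr_gt0.
have em0 : 0 < e / 2 / m by rewrite divr_gt0.
near (0 : R)^'+ => r.
have r0 : 0 < r by [].
have rt : r < t by near: r; exact: nbhs_right_lt.
rewrite -(is_derive0_constant dH r0 rt) HE// addrAC (le_trans (ler_normD _ _))//.
rewrite [leRHS]splitr lerD//.
  rewrite distrC ltW//; near: r; apply: (@cvgr_dist_lt _ _ _ _ _ (fun t : R => w `|t|)) => //.
  by have := cvg_at_right_filter (cW 0); rewrite normr0 w0.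
rewrite normrM gtr0_norm// mulrC -ler_pdivlMr// ltW//.
near: r; exact: rs_conv_small.
Unshelve. all: end_near. Qed.

End relaxation_to_volterra.


(** * Norm estimate for the Bochner integral *)

Section bochner_bound.
Import finmap.
Context d (T : measurableType d) (R : realType).
Variables (mu : {measure set T -> \bar R}) (V : normedModType R).
Local Open Scope ereal_scope.

Lemma simple_integral_norm_le (D : set T) (s : T -> V) (g : T -> \bar R) :
  measurable D -> simple_map s -> simple_integrable mu D s ->
  measurable_fun D g -> (forall x, D x -> (`|s x|%R)%:E <= g x) ->
  (`|simple_integral mu D s|%R)%:E <= \int[mu]_(x in D) g x.
Proof.
move=> mD [fins ms] ints mg sg.
have g0 x : D x -> 0 <= g x by move=> /sg; apply: le_trans; rewrite lee_fin.
pose F v := D `&` s @^-1` [set v].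
have mF v : measurable (F v) by apply: measurableI => //; exact: ms.
have DE : D = \big[setU/set0]_(v <- fset_set (range s)) F v.
  rewrite -bigcup_fset; apply/seteqP; split => [x Dx|x [v _ []//]].
  exists (s x); last by split.
  by rewrite /= in_fset_set//; apply/mem_set; exists x.
have -> : \int[mu]_(x in D) g x =
    \sum_(v <- fset_set (range s)) \int[mu]_(x in F v) g x.
  rewrite {1}DE ge0_integral_bigsetU//.
  - apply/trivIsetP => v w _ _ /eqP vw; apply/seteqP; split => // x.
    by move=> [[_ /= xv] [_ /= xw]]; apply: vw; rewrite -xv -xw.
  - by rewrite -DE.
  - by rewrite -DE.
rewrite /simple_integral fsbig_finite//=.
apply: (@le_trans _ _ (\sum_(v <- fset_set (range s)) (`|fine (mu (F v)) *: v|%R)%:E)).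
  by rewrite sumEFin lee_fin ler_norm_sum.
apply: lee_sum => v _.
(* The fibre over 0 may have infinite measure, but its term in the sum is zero. *)
have [->|v0] := eqVneq v 0%R.
  by rewrite scaler0 normr0 integral_ge0// => x [Dx _]; exact: g0.
rewrite normrZ ger0_norm ?fine_ge0// EFinM fineK; last first.
  by rewrite ge0_fin_numE//; exact: ints.
rewrite muleC -integral_cst//; apply: ge0_le_integral => //.
- by move=> x _; rewrite lee_fin.
- by apply: measurable_funS mg => // x [].
- by move=> x [Dx /= <-]; exact: sg.
Qed.

(** Integrate [|s n| <= |F - s n| + b] and let [n] grow. A measurable majorant [b] replaces [|F|],
    since [is_bochner_integral] speaks only of the measurability of [|F - s n|]. *)
Lemma bochner_norm_le (D : set T) (F : T -> V) (I : V) (b : T -> R) :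
  measurable D -> measurable_fun D b -> is_bochner_integral mu D F I ->
  (forall x, D x -> (`|F x| <= b x)%R) ->
  (`|I|%R)%:E <= \int[mu]_(x in D) (b x)%:E.
Proof.
move=> mD mb [s [simp mFs cvF cvI]] Fb.
have b0 x : D x -> 0 <= (b x)%:E.
  by move=> /Fb; rewrite lee_fin; apply: le_trans.
have [->|bfin] := eqVneq (\int[mu]_(x in D) (b x)%:E) +oo; first by rewrite leey.
have bn n : (`|simple_integral mu D (s n)|%R)%:E <=
    \int[mu]_(x in D) (`|F x - s n x|%R)%:E + \int[mu]_(x in D) (b x)%:E.
  have [sn isn] := simp n.
  rewrite -ge0_integralD//; [|by apply/measurable_EFinP; exact: mFs|by apply/measurable_EFinP].
  apply: simple_integral_norm_le => //.
    by apply/measurable_EFinP; apply: measurable_funD.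
  move=> x Dx; rewrite -EFinD lee_fin.
  rewrite -{1}[s n x](subKr (F x)) (le_trans (ler_normB _ _))// addrC.
  by rewrite lerD2l Fb.
have cvR : \int[mu]_(x in D) (`|F x - s n x|%R)%:E + \int[mu]_(x in D) (b x)%:E
    @[n --> \oo] --> 0 + \int[mu]_(x in D) (b x)%:E.
  apply: cvgeD; [|exact: cvF|exact: cvg_cst].
  by apply: ge0_adde_def; rewrite inE//; exact: integral_ge0.
rewrite -[leRHS]add0e; apply: (lee_cvg_to _ cvR); last by apply: nearW; exact: bn.
by apply: cvg_EFin; [exact: nearW|exact: cvg_norm].
Qed.

End bochner_bound.


(** * A uniform growth constant for [f] *)

Section growth_bound.
Context (R : realType) (V : normedModType R).
Notation mu := (@lebesgue_measure R).

(* A bound holding for almost every [s] holds for every [s], by continuity of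
   [f] and because a null set contains no interval. *)
Lemma linear_growth_ess_sup (f : R -> V -> V) (p : R -> R) (l : R) :
  {within [set z : R * V | 0 <= z.1], continuous (fun z => f z.1 z.2)} ->
  (forall (t : R) (v : V), 0 <= t -> `|f t v| <= p t * (1 + `|v|)) ->
  0 < l ->
  (ess_sup (mrestr mu (measurable_itv `[(0%R : R), +oo[%R)) (EFin \o p) < l%:E)%E ->
  exists P, [/\ 0 <= P, P < l &
    forall t v, 0 <= t -> `|f t v| <= P * (1 + `|v|)].
Proof.
move=> /subspace_continuousP cf fp l0 pl.
have [P [P0 Pl esP]] : exists P, [/\ 0 <= P, P < l &
    (ess_sup (mrestr mu (measurable_itv `[(0%R : R), +oo[%R)) (EFin \o p) <= P%:E)%E].
  (* The maximum with 0 ensures [0 <= P]; an essential supremum equal to [-oo] gives [P = 0]. *)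
  move: pl; case: (ess_sup _ _) => [r| |] //=.
  - rewrite lte_fin => rl; exists (Num.max 0 r).
    by rewrite le_max lexx gt_max l0 rl lee_fin le_max lexx orbT.
  - by move=> _; exists 0; rewrite leNye.
exists P; split => // t v t0; rewrite leNgt; apply/negP => Pf.
have cvf : `|f s v| @[s --> t^'+] --> `|f t v|.
  apply: cvg_norm.
  apply: (@cvg_comp _ _ _ (fun s => (s, v)) (fun z => f z.1 z.2) _
    (within [set z : R * V | 0 <= z.1] (nbhs (t, v)))); last exact: cf.
  move=> A nA.
  have cpair : (s, v) @[s --> t^'+] --> (t, v).
    apply: (@cvg_pair _ _ _ t^'+ (nbhs t) (nbhs v)); [exact: cvg_at_right_filter|exact: cvg_cst].
  have s0 : \forall s \near t^'+, 0 <= s.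
    by apply: filterS (nbhs_right_ge t) => s; exact: le_trans.
  by apply: filterS2 s0 (cpair _ nA) => s s0; apply.
have [e /= e0 eP] := cvgr_gt _ cvf _ Pf.
have /ess_supP[N [mN N0 sN]] := esP.
have sub : `]t, (t + e)%R[%classic `<=` N `&` `[0%R, +oo[%classic.
  move=> s /=; rewrite in_itv/= => /andP[ts ste].
  have s0 : 0 <= s by rewrite (le_trans t0)// ltW.
  split; last by rewrite /= in_itv/= s0.
  apply: sN => /=; rewrite lee_fin => psP.
  have : P * (1 + `|v|) < `|f s v|.
    by apply: eP => //=; rewrite distrC gtr0_norm ?subr_gt0//; lra.
  by apply/negP; rewrite -leNgt (le_trans (fp _ v s0))// ler_wpM2r.
have : (mu `]t, (t + e)%R[%classic <= 0)%E.
  by rewrite -[leRHS]N0; apply: le_measure => //; rewrite inE//; exact: measurableI.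
rewrite lebesgue_measure_itv/= lte_fin ltrDl e0 -EFinB lee_fin addrAC subrr add0r.
by rewrite leNgt e0.
Unshelve. all: end_near. Qed.

End growth_bound.

(** * The scalar integral inequality with delay *)

Section delay_inequality.
Context (R : realType).
Notation mu := (@lebesgue_measure R).
Variables (c alpha l P tau : R) (rho w y : R -> R).
Hypotheses (c0 : 0 <= c) (alpha0 : 0 < alpha) (alpha1 : alpha < 1).
Hypotheses (l0 : 0 < l) (P0 : 0 <= P) (Pl : P < l) (tau0 : 0 <= tau).
Hypothesis rho_bound : forall t : R, 0 <= t -> - tau <= t - rho t <= t.
Hypothesis rho_lim : t - rho t @[t --> +oo] --> +oo.
Hypothesis wsol : volterra_solution c alpha l w.
Hypotheses (y0 : forall t, 0 <= y t) (cy : {within `[- tau, +oo[, continuous y}).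
(** Stated for measurable majorants [b] of the integrand, the form that [bochner_norm_le]
    provides. *)
Hypothesis yle : forall (t : R) (b : R -> R), 0 <= t -> measurable_fun `[0, t] b ->
  (forall s, 0 <= s <= t -> w (t - s) * (P * (1 + y (s - rho s))) <= b s) ->
  ((y t)%:E <= (w t * y 0)%:E + \int[mu]_(s in `[0%R, t]) (b s)%:E)%E.

Let wgt0 t : 0 <= t -> 0 < w t.
Proof. exact: (volterra_solution_gt0 c0 alpha0 alpha1 l0 wsol). Qed.

Let cw : continuous w. Proof. by case: wsol. Qed.

Let mw t (D : set R) : measurable_fun D (fun s => w (t - s)).
Proof.
apply: measurable_funTS; apply: (@measurableT_comp _ _ _ _ _ _ w).
  exact: continuous_measurable_fun.
exact: measurable_reflection.
Qed.

Let int_w_le (C t : R) : 0 <= C -> 0 <= t ->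
  (\int[mu]_(s in `[0%R, t]) (w (t - s) * C)%:E <= (C / l)%:E)%E.
Proof.
move=> C0 t0.
under eq_integral do rewrite mulrC EFinM.
rewrite ge0_integralZl//; last 2 first.
- by apply/measurable_EFinP; exact: mw.
- move=> s /=; rewrite in_itv/= lee_fin => /andP[_ st].
  by rewrite ltW// wgt0// subr_ge0.
rewrite EFinM lee_wpmul2l ?lee_fin//.
exact: (volterra_solution_integral_le c0 alpha0 alpha1 l0 wsol t0).
Qed.

(** At a maximum point [s > 0] of [y] on [[- tau, T]] all delayed values are at most [y s], so
    [y s <= K0 + P * (1 + y s) / l], where [K0] bounds the initial history. *)
Lemma delay_inequality_bounded : exists M, 0 <= M /\ forall t, - tau <= t -> y t <= M.
Proof.
have cyab a : {within `[- tau, a], continuous y}.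
  by apply: continuous_subspaceW cy => x /=; rewrite !in_itv/= => /andP[->].
have [s0 _ K0P] := @EVT_max R y (- tau) 0 (ltac:(by rewrite oppr_le0)) (cyab 0).
move: (y s0) (y0 s0) K0P => K0 K00 K0P.
have lP : 0 < l - P by rewrite subr_gt0.
(* The solution of [M = K0 + P * (1 + M) / l], independent of [T]. *)
pose M := (l * K0 + P) / (l - P).
have K0M : K0 <= M.
  by rewrite ler_pdivlMr//; have := mulr_ge0 P0 K00; have := P0; lra.
exists M; split; first exact: le_trans K0M.
move=> T tT.
have [s] := @EVT_max R y (- tau) T tT (cyab T).
rewrite in_itv/= => /andP[ts sT] smax.
apply: (@le_trans _ _ (y s)); first by apply: smax; rewrite in_itv/= lexx tT.
have [s_le0|s_gt0] := leP s 0.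
  by apply: le_trans K0M; apply: K0P; rewrite in_itv/= ts.
have ys0 := y0 s.
have h : ((y s)%:E <= (w s * y 0)%:E + \int[mu]_(r in `[0%R, s]) (w (s - r) * (P * (1 + y s)))%:E)%E.
  apply: yle; first exact: ltW.
    by apply: measurable_funM => //; exact: mw.
  move=> r /andP[r0 rs]; rewrite ler_wpM2l//.
    by rewrite ltW// wgt0// subr_ge0.
  rewrite ler_wpM2l// lerD2l; apply: smax; rewrite in_itv/=.
  by have := rho_bound r0; lra.
have C0 : 0 <= P * (1 + y s) by rewrite mulr_ge0// addr_ge0.
have := le_trans h (leeD2l _ (int_w_le C0 (ltW s_gt0))).
rewrite -EFinD lee_fin => {}h.
have wy : w s * y 0 <= K0.
  apply: (@le_trans _ _ (y 0)).
    rewrite ler_piMl// (volterra_solution_le1 c0 alpha0 alpha1 l0 wsol)//; exact: ltW.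
  by apply: K0P; rewrite in_itv/= lexx oppr_le0 tau0.
have {h wy} : y s <= K0 + P * (1 + y s) / l by rewrite (le_trans h)// lerD2r.
rewrite -lerBlDl ler_pdivlMr// /M ler_pdivlMr// => h; lra.
Qed.

Definition eventual_bound (m : R) := exists T, 0 <= T /\ forall t, T <= t -> y t <= m.

(** After a time [T1] the delayed argument stays beyond [T], so that part of the integral is
    controlled by [m]. The earlier part and the initial term are bounded by a multiple of
    [w (t - T1)], which decays. *)
Lemma eventual_bound_improve (m e : R) : eventual_bound m -> 0 < e ->
  eventual_bound (P * (1 + m) / l + e).
Proof.
move=> [T [T0 Tm]] e0.
have [M [M0 yM]] := delay_inequality_bounded.
have m0 : 0 <= m by apply: le_trans (Tm T (lexx _)).
have [T1 T10 T1P] : exists2 T1, 0 < T1 & forall s, T1 <= s -> T <= s - rho s.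
  have /cvgryPge/(_ T)[A [Ar AP]] := rho_lim.
  exists (`|A| + 1); first by rewrite ltr_wpDl.
  move=> s As; apply: AP; rewrite (lt_le_trans _ As)// (le_lt_trans (ler_norm A))//.
  by rewrite ltrDl.
pose C1 := P * (1 + m); pose C2 := P * (1 + M).
have C10 : 0 <= C1 by rewrite mulr_ge0// addr_ge0.
have C20 : 0 <= C2 by rewrite mulr_ge0// addr_ge0.
(* By the decay estimate [w (t - T1) * (M + C2 * T1) <= K / (t - T1)], which is at most [e] once
   [t - T1 >= K / e]; the extra 1 in the time below keeps [T1 < t] when [K = 0]. *)
pose K := (M + C2 * T1) / l.
have K0 : 0 <= K by rewrite divr_ge0 ?(ltW l0)// addr_ge0// mulr_ge0// ltW.
have Ke : 0 <= K / e by rewrite divr_ge0// ltW.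
exists (T1 + K / e + 1); split; first lra.
move=> t Tt.
have T1t : T1 < t by lra.
have t0 : 0 <= t by lra.
have wT : 0 < w (t - T1) by apply: wgt0; lra.
(* For [s <= T1] monotonicity gives [w (t - s) <= w (t - T1)]. *)
pose b s := w (t - s) * C1 + w (t - T1) * C2 * \1_(`[0%R, T1]) s.
have mb1 (D : set R) : measurable_fun D (fun s => w (t - s) * C1).
  by apply: measurable_funM => //; exact: mw.
have mb2 (D : set R) : measurable_fun D (fun s => w (t - T1) * C2 * \1_(`[0%R, T1]) s).
  by apply: measurable_funM => //; exact: measurable_funTS.
have D0 : 0 <= w (t - T1) * C2 by rewrite mulr_ge0// ltW.
have h : ((y t)%:E <= (w t * y 0)%:E + \int[mu]_(s in `[0%R, t]) (b s)%:E)%E.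
  apply: yle => //.
    exact: measurable_funD.
  move=> s /andP[s0 st]; have ws : 0 < w (t - s) by apply: wgt0; lra.
  rewrite /b; have [T1s|sT1] := leP T1 s.
    have ys := Tm _ (T1P _ T1s).
    rewrite (@le_trans _ _ (w (t - s) * C1))//.
      by rewrite ler_pM2l// ler_wpM2l// lerD2l.
    by rewrite lerDl mulr_ge0// indicE.
  rewrite indicE mem_set; last by rewrite /= in_itv/= s0 ltW.
  rewrite mulr1 (@le_trans _ _ (w (t - T1) * C2))//; last first.
    by rewrite lerDr mulr_ge0// ltW.
  apply: ler_pM; [exact: ltW| |by apply: (volterra_solution_nonincreasing c0 alpha0 alpha1 l0 wsol); lra|].
    by rewrite mulr_ge0// addr_ge0.
  by rewrite ler_wpM2l// lerD2l yM//; have := rho_bound s0; lra.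
have ib2 : (\int[mu]_(s in `[0%R, t]) (w (t - T1) * C2 * \1_(`[0%R, T1]) s)%:E
    <= (w (t - T1) * C2 * T1)%:E)%E.
  under eq_integral do rewrite EFinM.
  rewrite ge0_integralZl//; last first.
    by apply/measurable_EFinP; apply: measurable_funTS; exact: measurable_indic.
  rewrite [leRHS]EFinM lee_wpmul2l ?lee_fin// integral_indic//.
  apply: (@le_trans _ _ (mu `[0%R, T1]%classic)).
    by apply: le_measure; rewrite ?inE//; exact: measurableI.
  by rewrite lebesgue_measure_itv/= lte_fin T10 -EFinB subr0.
have {}h : y t <= w t * y 0 + (C1 / l + w (t - T1) * C2 * T1).
  rewrite -lee_fin EFinD (le_trans h)// leeD2l// /b.
  under eq_integral do rewrite EFinD.
  rewrite ge0_integralD//; last 4 first.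
  - move=> s /=; rewrite in_itv/= lee_fin => /andP[_ st].
    by rewrite mulr_ge0// ltW// wgt0// subr_ge0.
  - by apply/measurable_EFinP; exact: mb1.
  - by move=> s _; rewrite lee_fin mulr_ge0// indicE.
  - by apply/measurable_EFinP; exact: mb2.
  by rewrite EFinD leeD// int_w_le.
have wtT : w t <= w (t - T1).
  by apply: (volterra_solution_nonincreasing c0 alpha0 alpha1 l0 wsol); lra.
have y0M : y 0 <= M by apply: yM; rewrite oppr_le0.
have dec := volterra_solution_decay c0 alpha0 alpha1 l0 wsol (_ : 0 < t - T1).
have {dec}dec : w (t - T1) * (l * (t - T1)) <= 1.
  by rewrite -ler_pdivlMr ?mulr_gt0 ?subr_gt0// div1r dec// subr_gt0.
have wK : w (t - T1) * (M + C2 * T1) <= e.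
  have Kl : M + C2 * T1 = K * l by rewrite /K divfK// gt_eqF.
  have KT : K <= e * (t - T1) by rewrite mulrC -ler_pdivrMr//; lra.
  rewrite Kl (@le_trans _ _ (w (t - T1) * (e * (t - T1) * l)))//.
    by rewrite ler_pM2l// ler_pM2r.
  rewrite (_ : _ * _ = e * (w (t - T1) * (l * (t - T1)))); last by ring.
  by rewrite ler_piMr// ltW.
have wy : w t * y 0 <= w (t - T1) * M by apply: ler_pM => //; exact/ltW/wgt0.
rewrite -/C1 (le_trans h)// addrCA lerD2l (le_trans _ wK)//.
by rewrite mulrDr mulrA lerD2r.
Qed.

Lemma delay_inequality_absorbing :
  exists t0, 0 <= t0 /\ forall t, t0 <= t -> y t <= P / (l - P) + 1.
Proof.
have lP : 0 < l - P by rewrite subr_gt0.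
pose S := [set m | eventual_bound m].
have S0 m : S m -> 0 <= m by move=> [T [_ TP]]; apply: le_trans (TP T (lexx _)).
have hS : has_inf S.
  split; last by exists 0 => m /S0.
  have [M [M0 yM]] := delay_inequality_bounded.
  exists M, 0; split => // t t0; apply: yM.
  by rewrite (le_trans _ t0)// oppr_le0.
have lb := ge_inf hS.2.
have infle : inf S <= P / (l - P).
  rewrite leNgt; apply/negP => lt_inf.
  have [g g0 gE] : exists2 g, 0 < g & inf S = P * (1 + inf S) / l + g.
    exists (inf S - P * (1 + inf S) / l); last by rewrite addrC subrK.
    by move: lt_inf; rewrite ltr_pdivrMr// subr_gt0 ltr_pdivrMr//; lra.
  (* Take [m] within [g / 2] of the infimum and improve it with error [g / 4]. As [P / l < 1], the
     new bound is at most [inf S - g / 4], a contradiction. *)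
  have [m Sm mlt] := inf_adherent (divr_gt0 g0 (ltr0Sn R 1)) hS.
  have := lb _ (eventual_bound_improve Sm (divr_gt0 g0 (ltr0Sn R 3))).
  have : P * (1 + m) / l <= P * (1 + inf S) / l + g / 2.
    rewrite -lerBlDl -mulrBl ler_pdivrMr//.
    have h1 := ler_wpM2l P0 (ltW mlt).
    have h2 : P * (g / 2) <= l * (g / 2) by rewrite ler_wpM2r ?ltW// divr_gt0.
    by move: h1 h2; rewrite mulrDr; lra.
  by lra.
(* The infimum may not be attained, whence the margin 1 in the statement. *)
have [m Sm mlt] := inf_adherent (@ltr01 R) hS.
have [T [T0 TP]] := Sm.
exists T; split => // t /TP; lra.
Qed.

End delay_inequality.

(** * The absorbing ball for mild solutions *)

Theorem theorem3p4 (R : realType) (d : nat) (Om : smooth_bounded_domain R d)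
    (gamma alpha tau : R) (rho : R -> R)
    (omega : R -> R -> R) (lam : nat -> R) (phi : nat -> L2 Om)
    (f : R -> L2 Om -> L2 Om) (p : R -> R)
    (gamma_gt0 : 0 < gamma) (alpha_gt0 : 0 < alpha) (alpha_lt1 : alpha < 1)
    (tau_ge0 : 0 <= tau)
    (rho_cont : {within `[0, +oo[, continuous rho})
    (rho_bound : forall t : R, 0 <= t -> - tau <= t - rho t <= t)
    (rho_lim : t - rho t @[t --> +oo] --> +oo)
    (omega_sol : forall mu : R, 0 < mu ->
      relaxation_solution gamma alpha mu (fun t => omega t mu))
    (lam_gt0 : 0 < lam 0%N)
    (lam_nondecreasing : forall n, lam n <= lam n.+1)
    (lam_cvg : lam n @[n --> \oo] --> +oo)
    (phi_basis : orthonormal_basis phi)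
    (phi_eigen : forall n, dirichlet_eigenfunction (lam n) (phi n))
    (f_cont : {within [set z : R * L2 Om | 0 <= z.1],
      continuous (fun z => f z.1 z.2)})
    (f_bound : forall (t : R) (v : L2 Om), 0 <= t -> `|f t v| <= p t * (1 + `|v|))
    (p_ge0 : forall t : R, 0 <= t -> 0 <= p t)
    (p_int : forall T : R, 0 < T ->
      completed_lebesgue_measure.-integrable `]0, T[ (EFin \o p))
    (p_sup : (ess_sup (mrestr lebesgue_measure (measurable_itv `[(0%R : R), +oo[%R))
      (EFin \o p) < (lam 0%N)%:E)%E) :
  exists B : set (L2 Om), bounded_set B /\
    forall xi u : R -> L2 Om,
      {within `[- tau, 0], continuous xi} ->
      mild_solution (resolvent omega lam phi) tau rho f xi u ->
      exists t0 : R, 0 <= t0 /\ forall t : R, t0 <= t -> B (u t).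
Proof.
have [P [P0 Pl fP]] := linear_growth_ess_sup f_cont f_bound lam_gt0 p_sup.
have c0 := relaxation_coef_ge0 alpha gamma_gt0.
pose w (t : R) := omega `|t| (lam 0%N).
have lam0n n : lam 0%N <= lam n.
  by elim: n => // n IH; exact: le_trans (lam_nondecreasing n).
have sol n : volterra_solution (relaxation_coef gamma alpha) alpha (lam n)
    (fun t : R => omega `|t| (lam n)).
  have ln := lt_le_trans lam_gt0 (lam0n n).
  exact: (relaxation_volterra_solution gamma_gt0 alpha_lt1 ln (omega_sol _ ln)).
(* The multipliers [omega t (lam n)] are positive and largest at the smallest eigenvalue [lam 0]. *)
have Sle (t : R) v : 0 <= t -> `|resolvent omega lam phi t v| <= w t * `|v|.
  move=> t0; apply: resolvent_norm_le => // n.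
  have ln := lt_le_trans lam_gt0 (lam0n n).
  have := volterra_solution_gt0 c0 alpha_gt0 alpha_lt1 ln (sol n) t0.
  have := volterra_solution_le_coef c0 alpha_gt0 alpha_lt1 lam_gt0 (lam0n n)
    (sol 0%N) (sol n) t0.
  by rewrite /w ger0_norm// => + /gtr0_norm ->.
(* The radius depends only on [P] and the first eigenvalue, hence not on [xi]. *)
exists [set v | `|v| <= P / (lam 0%N - P) + 1]; split.
  by exists (P / (lam 0%N - P) + 1); split => [|x xlt v /= /le_trans]; [exact: num_real|apply; exact: ltW].
move=> xi u cxi [cu uxi umild].
apply: (@delay_inequality_absorbing _ _ _ _ _ _ _ _ (fun t => `|u t|) c0 alpha_gt0 alpha_lt1
  lam_gt0 P0 Pl tau_ge0 rho_bound rho_lim (sol 0%N)) => //.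
  by move=> x; apply: cvg_norm; exact: cu.
move=> t b t0 mb bP; have [I bI ->] := umild _ t0.
have xi0 : xi 0 = u 0 by rewrite uxi// oppr_le0 tau_ge0 lexx.
apply: (@le_trans _ _ ((`|resolvent omega lam phi t (xi 0)|)%:E + (`|I|)%:E)%E).
  by rewrite -EFinD lee_fin ler_normD.
apply: leeD; first by rewrite lee_fin xi0 Sle.
apply: (bochner_norm_le _ _ bI) => [||s /=]; [exact: measurable_itv|exact: mb|].
rewrite in_itv/= => /andP[s0 st].
have ts : 0 <= t - s by rewrite subr_ge0.
apply: le_trans (bP s _); last by rewrite s0.
rewrite (le_trans (Sle _ _ ts))// ler_wpM2l ?fP//.
by have := volterra_solution_gt0 c0 alpha_gt0 alpha_lt1 lam_gt0 (sol 0%N) ts; exact: ltW.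
Qed.
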